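(* Let $\alpha_0=\sqrt{1-1/(4\pi^2)}$. For every $\alpha\in(\alpha_0,1]$ there is a constant $c(\alpha)>0$ (depending only on $\alpha-\alpha_0$) such that for all positive integers $d,n$ and all $\delta\in[0,1]$, every $2$-query $(\alpha,\delta)$-approximate LDC of size $n$ and dimension $d$ satisfies $n\ge 2^{c(\alpha)\,\delta d}$.
   Context: For $\vec u\in\mathbb R^d$ nonzero, $\mathsf{weight}_i(\vec u)=|\langle \vec u,\vec e_i\rangle|/\|\vec u\|_2$, where $\vec e_i$ is the $i$-th standard basis vector. A $q$-matching in $[n]$ is a set of pairwise disjoint $q$-element subsets of $[n]$. A $q$-query $(\alpha,\delta)$-approximate LDC of size $n$ and dimension $d$ is a pair $(V,M)$ where $V=\{\vec v_1,\dots,\vec v_n\}$ is a multiset of vectors in $\mathbb R^d$ and $M=(M_1,\dots,M_d)$, each $M_i$ a $q$-matching in $[n]$, such that for every $i\in[d]$ and every $\{j_1,\dots,j_q\}\in M_i$ there is $\vec u\in\mathrm{span}\{\vec v_{j_1},\dots,\vec v_{j_q}\}$ with $\mathsf{weight}_i(\vec u)\ge\alpha$, and $|M_1|+\cdots+|M_d|\ge \delta d n$. *)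

(* Defs.v *)
From HB Require Import structures.
From mathcomp Require Import all_boot all_order all_algebra.
From mathcomp Require Import reals trigo exp.

Set Implicit Arguments.
Unset Strict Implicit.
Unset Printing Implicit Defensive.

Import Order.TTheory GRing.Theory Num.Theory.
Local Open Scope ring_scope.

Definition dotp (R : realType) (d : nat) (u v : 'rV[R]_d) : R :=
  \sum_(k < d) u 0 k * v 0 k.

(* The library's norm on ['rV[R]_d] is the sup norm, hence a separate
   definition of the Euclidean norm. *)
Definition norm2 (R : realType) (d : nat) (u : 'rV[R]_d) : R :=
  Num.sqrt (dotp u u).

(* [delta_mx 0 i] is the [i]-th standard basis row vector. *)
Definition weight (R : realType) (d : nat) (i : 'I_d) (u : 'rV[R]_d) : R :=
  `|dotp u (delta_mx 0 i)| / norm2 u.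

Definition is_qmatching (q n : nat) (P : {set {set 'I_n}}) : Prop :=
  trivIset P /\ (forall A : {set 'I_n}, A \in P -> #|A| = q).

(* The multiset of vectors is the indexed family [v] (repetitions allowed).
   The weight is only meaningful on nonzero vectors, so [u != 0] is required. *)
Definition approx_LDC (R : realType) (q : nat) (alpha delta : R) (n d : nat)
    (v : 'I_n -> 'rV[R]_d) (M : 'I_d -> {set {set 'I_n}}) : Prop :=
  [/\ forall i : 'I_d, is_qmatching q (M i),
      forall (i : 'I_d) (A : {set 'I_n}), A \in M i ->
        exists u : 'rV[R]_d,
          [/\ u \in <<[seq v j | j <- enum A]>>%VS, u != 0 &
              alpha <= weight i u]
    & delta * d%:R * n%:R <= (\sum_(i < d) #|M i|)%:R].

Definition alpha0 (R : realType) : R := Num.sqrt (1 - 1 / (4 * pi ^+ 2)).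

(* Main.v *)
Require Import Defs.
From mathcomp Require Import all_boot all_order all_algebra.
From mathcomp Require Import boolp functions reals topology normedtype.
From mathcomp Require Import sequences derive realfun trigo exp ring lra.

Set Implicit Arguments.
Unset Strict Implicit.
Unset Printing Implicit Defensive.

Import Order.TTheory GRing.Theory Num.Theory.
Import numFieldNormedType.Exports.
Local Open Scope classical_set_scope.
Local Open Scope ring_scope.

(** Rescale each vector to [w_a = v_a / <v_a, rho>]. If the plane spanned by [v_a]
    and [v_b] contains a unit vector [u] close to [e_i], then [w_a - w_b] is the
    direction of that plane orthogonal to [rho]; for random [rho] it is, with
    constant probability, within a bounded angle of [u], so that its [i]-th
    coordinate carries a constant fraction of its length. Only the few pairs with
    [v_a] and [v_b] parallel escape.

    The differences [w_a - w_b] may have wildly different lengths. For each dyadic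
    scale [s] and coordinate [k] draw a sign [x_(s,k)] and put on the vertex [a]
    the phase [sum_(s,k) x_(s,k) w_a,k / 2^(s+1)]. For a pair of direction [i] and
    length about [2^s], the signs of the finer scales can be cancelled once known,
    the coarser ones contribute little, and the remaining phase difference is
    correlated with [x_(s,i)]: the state [sum_a exp(i phase_a) |a>], of real
    dimension [2n], is a serial quantum random access code for the signs.

    The dimension bound for such a code is obtained as for matrix martingales.
    Step [t] multiplies by [1 + h H_t / 2], with [H_t = lam x_t A_t - 4 lam^2 A_t^2]
    for the signed matching matrix [A_t]. Araki-Lieb-Thirring bounds the average
    trace of the [1/h]-th power of the resulting Gram matrix by the dimension, and
    letting [h] tend to [0] bounds the average of [sum_t <z, H_t z>] by its logarithm.
    The correction [- 4 lam^2 A_t^2] makes the bound linear in the number of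
    matched pairs. *)

Lemma sqr_le_mul_of_quadratic_ge0 (R : realFieldType) (a b c : R) :
  0 <= c -> (forall t, 0 <= a + 2 * b * t + c * t ^+ 2) -> b ^+ 2 <= a * c.
Proof.
rewrite le0r => /predU1P[->|c0] quadratic_ge0.
  rewrite mulr0 -[leRHS](expr0n _ 2); suff -> : b = 0 by [].
  apply/eqP; apply: contraT => b0; have := quadratic_ge0 (- (a + 1) / (2 * b)).
  have -> : a + 2 * b * (- (a + 1) / (2 * b)) + 0 * (- (a + 1) / (2 * b)) ^+ 2 = -1 by field.
  lra.
have := quadratic_ge0 (- b / c); rewrite -(pmulr_rge0 _ c0).
have -> : c * (a + 2 * b * (- b / c) + c * (- b / c) ^+ 2) = a * c - b ^+ 2 by field; lra.
by rewrite subr_ge0.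
Qed.

(** * A trace inequality of Araki-Lieb-Thirring type *)

Section MatrixRing.
Variables (R : comPzRingType) (m : nat).
Implicit Types X Y : 'M[R]_m.

Lemma trmxM X Y : (X * Y)^T = Y^T * X^T.
Proof. exact: trmx_mul. Qed.

Lemma trmxX X k : (X ^+ k)^T = X^T ^+ k.
Proof. by elim: k => [|k IH]; rewrite ?expr0 ?trmx1 // exprS trmxM IH -exprSr. Qed.

Lemma mxtraceMC X Y : \tr (X * Y) = \tr (Y * X).
Proof. exact: mxtrace_mulC. Qed.

Lemma mxtrace_mulX X Y k : \tr ((X * Y) ^+ k) = \tr ((Y * X) ^+ k).
Proof.
case: k => [|k]; first by rewrite !expr0.
have XYX j : (X * Y) ^+ j * X = X * (Y * X) ^+ j.
  by elim: j => [|j IH]; rewrite ?mul1r ?mulr1 // exprS -mulrA IH exprS !mulrA.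
by rewrite exprSr mulrA XYX mxtraceMC mulrA -exprS.
Qed.

End MatrixRing.

Section TraceInequality.
Variables (R : realDomainType) (m : nat).
Implicit Types X Y Z : 'M[R]_m.

Lemma mxtrace_gram_ge0 X : 0 <= \tr (X * X^T).
Proof.
rewrite sumr_ge0 // => i _; rewrite mxE sumr_ge0 // => j _.
by rewrite mxE -expr2 sqr_ge0.
Qed.

Lemma mxtrace_sqr_le X : \tr (X * X) <= \tr (X * X^T).
Proof.
have := mxtrace_gram_ge0 (X - X^T).
rewrite linearB /= trmxK mulrBl !mulrBr !raddfB /=.
by rewrite (mxtraceMC X^T X) -trmxM mxtrace_tr; lra.
Qed.

Lemma mxtrace_mul_sym_le X Y : X^T = X -> Y^T = Y ->
  2 * \tr (X * Y) <= \tr (X * X) + \tr (Y * Y).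
Proof.
move=> sX sY; have := mxtrace_gram_ge0 (X - Y).
by rewrite linearB /= sX sY mulrBl !mulrBr !raddfB /= (mxtraceMC Y X); lra.
Qed.

Lemma mxtrace_ArakiLiebThirring k X Y : X^T = X -> Y^T = Y ->
  \tr ((X * Y) ^+ (2 ^ k)) <= \tr (X ^+ (2 ^ k) * Y ^+ (2 ^ k)).
Proof.
suff [] : (forall Z, \tr (Z ^+ (2 ^ k.+1)) <= \tr ((Z * Z^T) ^+ (2 ^ k))) /\
    (forall X Y, X^T = X -> Y^T = Y ->
      \tr ((X * Y) ^+ (2 ^ k)) <= \tr (X ^+ (2 ^ k) * Y ^+ (2 ^ k))).
  by move=> _; apply.
elim: k {X Y} => [|k [sqr_le mul_le]].
  by split=> [Z|X Y _ _]; rewrite ?expn0 ?expn1 ?expr2 ?expr1 // mxtrace_sqr_le.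
have sqrX Z : Z ^+ (2 ^ k.+1) = (Z * Z) ^+ (2 ^ k) by rewrite -expr2 -exprM -expnS.
split=> [Z|X Y sX sY]; last first.
  apply: le_trans (sqr_le _) _; rewrite !sqrX.
  have -> : X * Y * (X * Y)^T = X * (Y * Y * X) by rewrite trmxM sX sY !mulrA.
  by rewrite mxtrace_mulX -(mulrA _ X) mxtrace_mulX mul_le ?trmxM ?sX ?sY.
rewrite expnS exprM expr2; apply: le_trans (sqr_le _) _.
set P := Z^T * Z; set Q := Z * Z^T.
have sP : P^T = P by rewrite trmxM trmxK.
have sQ : Q^T = Q by rewrite trmxM trmxK.
have -> : Z * Z * (Z * Z)^T = Z * (Q * Z^T) by rewrite trmxM !mulrA.
rewrite mxtrace_mulX -mulrA; apply: le_trans (mul_le _ _ sQ sP) _.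
have := @mxtrace_mul_sym_le (Q ^+ (2 ^ k)) (P ^+ (2 ^ k)).
rewrite !trmxX sQ sP -!expr2 -!exprM -[(2 ^ k * 2)%N]expnSr => /(_ erefl erefl).
by rewrite (mxtrace_mulX Z^T Z) -/Q; lra.
Qed.

Lemma mxtrace_conj_exp2_le k X G : X^T = X -> G^T = G ->
  \tr ((G * X * G) ^+ (2 ^ k)) <= \tr (X ^+ (2 ^ k) * G ^+ (2 * 2 ^ k)).
Proof.
move=> sX sG; rewrite -mulrA mxtrace_mulX -mulrA exprM expr2.
by apply: mxtrace_ArakiLiebThirring; rewrite ?trmxM ?sG.
Qed.

End TraceInequality.

Section DotProduct.
Variables (R : realType) (d : nat).
Implicit Types u v w : 'rV[R]_d.

Lemma dotpE u v : dotp u v = (u *m v^T) 0 0.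
Proof. by rewrite mxE; apply: eq_bigr => k _; rewrite mxE. Qed.

Lemma dotpC u v : dotp u v = dotp v u.
Proof. by apply: eq_bigr => k _; rewrite mulrC. Qed.

Lemma dotpDl u v w : dotp (u + v) w = dotp u w + dotp v w.
Proof. by rewrite !dotpE mulmxDl mxE. Qed.

Lemma dotpZl c u v : dotp (c *: u) v = c * dotp u v.
Proof. by rewrite !dotpE -scalemxAl mxE. Qed.

Lemma dotpDr u v w : dotp w (u + v) = dotp w u + dotp w v.
Proof. by rewrite !(dotpC w) dotpDl. Qed.

Lemma dotpZr c u v : dotp v (c *: u) = c * dotp v u.
Proof. by rewrite !(dotpC v) dotpZl. Qed.

Lemma dotpNl u v : dotp (- u) v = - dotp u v.
Proof. by rewrite -scaleN1r dotpZl mulN1r. Qed.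

Lemma dotpNr u v : dotp v (- u) = - dotp v u.
Proof. by rewrite !(dotpC v) dotpNl. Qed.

Definition dotp_lin := (dotpDl, dotpDr, dotpZl, dotpZr, dotpNl, dotpNr).

Lemma sum_sqr_dotp u : \sum_k u 0 k ^+ 2 = dotp u u.
Proof. by apply: eq_bigr => k _; rewrite expr2. Qed.

Lemma dotp_ge0 u : 0 <= dotp u u.
Proof. by rewrite -sum_sqr_dotp sumr_ge0 // => k _; rewrite sqr_ge0. Qed.

Lemma dotp_gt0 u : u != 0 -> 0 < dotp u u.
Proof.
move=> u0; rewrite lt_def dotp_ge0 andbT; apply: contra_neq u0.
rewrite -sum_sqr_dotp => /eqP; rewrite psumr_eq0 => [/allP h|k _]; last exact: sqr_ge0.
apply/rowP => k; have := h k (mem_index_enum _).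
by rewrite sqrf_eq0 mxE => /eqP.
Qed.

Lemma dotp_unit_neq0 u : dotp u u = 1 -> u != 0.
Proof.
by apply: contra_eq_neq => ->; rewrite -(scale0r 0) dotpZl mul0r eq_sym oner_eq0.
Qed.

Lemma dotp_delta u i : dotp u (delta_mx 0 i) = u 0 i.
Proof.
rewrite /dotp (bigD1 i) //= big1 ?addr0 => [|k ki]; rewrite mxE !eqxx /= ?mulr1 //.
by rewrite (negbTE ki) mulr0.
Qed.

Lemma sqr_dotp_le u v : dotp u v ^+ 2 <= dotp u u * dotp v v.
Proof.
apply: sqr_le_mul_of_quadratic_ge0 => [|t]; first exact: dotp_ge0.
have := dotp_ge0 (u + t *: v); rewrite !dotp_lin (dotpC v u).
by congr (0 <= _); ring.
Qed.

Lemma bessel2 u v i : dotp u u = 1 -> dotp v v = 1 -> dotp u v = 0 ->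
  u 0 i ^+ 2 + v 0 i ^+ 2 <= 1.
Proof.
move=> uu vv uv; have := dotp_ge0 (delta_mx 0 i - u 0 i *: u - v 0 i *: v).
rewrite !dotp_lin uu vv uv (dotpC v u) uv !(dotpC (delta_mx 0 i)) !dotp_delta mxE !eqxx /=.
lra.
Qed.

Lemma exists_unit_scale u : u != 0 -> exists2 c, 0 < c & dotp (c *: u) (c *: u) = 1.
Proof.
move=> /dotp_gt0 uu; exists (Num.sqrt (dotp u u))^-1; first by rewrite invr_gt0 sqrtr_gt0.
by rewrite !dotp_lin mulrA -invfM -expr2 sqr_sqrtr ?ltW // mulVf // gt_eqF.
Qed.

End DotProduct.

Lemma dotp_mulmx (R : realType) m n (u : 'rV[R]_m) (v : 'rV[R]_n) (A : 'M[R]_(m, n)) :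
  dotp (u *m A) v = dotp u (v *m A^T).
Proof. by rewrite !dotpE trmx_mul trmxK mulmxA. Qed.

Section QuadraticForm.
Variables (R : realType) (m : nat).
Implicit Types (X : 'M[R]_m) (u : 'rV[R]_m).

Definition quad X u : R := dotp (u *m X) u.

Lemma quad_sqr X u : X^T = X -> quad (X * X) u = dotp (u *m X) (u *m X).
Proof. by move=> sX; rewrite /quad -mulmxE mulmxA dotp_mulmx sX. Qed.

Lemma sqr_quad_le X u : X^T = X -> quad X u ^+ 2 <= dotp u u * quad (X * X) u.
Proof. by move=> sX; rewrite quad_sqr // mulrC sqr_dotp_le. Qed.

Lemma dotp_mulmx_le X u : dotp (u *m X) (u *m X) <= dotp u u * \tr (X^T * X).
Proof.
rewrite -[leLHS]sum_sqr_dotp /mxtrace mulr_sumr; apply: ler_sum => k _.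
have -> : (u *m X) 0 k = dotp u (col k X)^T.
  by rewrite mxE; apply: eq_bigr => j _; rewrite !mxE.
have -> : (X^T * X) k k = dotp (col k X)^T (col k X)^T.
  by rewrite mxE; apply: eq_bigr => j _; rewrite !mxE.
exact: sqr_dotp_le.
Qed.

Lemma quad_exp2_le X u k : X^T = X ->
  quad X u ^+ (2 ^ k) * dotp u u <= dotp u u ^+ (2 ^ k) * quad (X ^+ (2 ^ k)) u.
Proof.
elim: k X => [|k IH] X sX; first by rewrite !expr1 mulrC.
have uu := dotp_ge0 u.
have sXX : (X * X)^T = X * X by rewrite trmxM sX.
rewrite expnS !exprM expr2.
apply: le_trans (_ : (dotp u u * quad (X * X) u) ^+ (2 ^ k) * dotp u u <= _).
  by rewrite ler_wpM2r // lerXn2r ?sqr_quad_le ?nnegrE ?sqr_ge0 ?quad_sqr ?mulr_ge0 ?dotp_ge0.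
by rewrite exprMn -mulrA -exprM mulnC exprM expr2 -mulrA ler_wpM2l ?exprn_ge0 // IH.
Qed.

Lemma quad_exp2_trace_le X u k : (0 < k)%N -> X^T = X -> 0 < dotp u u ->
  quad X u ^+ (2 ^ k) <= dotp u u ^+ (2 ^ k) * \tr (X ^+ (2 ^ k)).
Proof.
case: k => // k _ sX u0; rewrite -(ler_pM2r u0).
apply: le_trans (quad_exp2_le u k.+1 sX) _.
rewrite -mulrA ler_wpM2l ?exprn_ge0 ?dotp_ge0 //.
rewrite expnS mul2n -addnn exprD quad_sqr ?trmxX ?sX // [leRHS]mulrC.
by apply: le_trans (dotp_mulmx_le _ _) _; rewrite trmxX sX.
Qed.

End QuadraticForm.

(** * Averages over random signs *)

Section SignAverage.
Variable R : realFieldType.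
Implicit Types (T : nat) (F G : seq bool -> R) (xs : seq bool) (c : seq R).

Fixpoint avg T F : R :=
  if T is T'.+1 then
    (avg T' (fun xs => F (false :: xs)) + avg T' (fun xs => F (true :: xs))) / 2
  else F [::].

Lemma avg_le T F G :
  (forall xs, size xs = T -> F xs <= G xs) -> avg T F <= avg T G.
Proof.
elim: T F G => [|T IH] F G FG /=; first exact: FG.
by rewrite ler_pM2r ?invr_gt0 // lerD // IH // => xs sxs; rewrite FG //= sxs.
Qed.

Lemma eq_avg T F G :
  (forall xs, size xs = T -> F xs = G xs) -> avg T F = avg T G.
Proof. by move=> FG; apply/eqP; rewrite eq_le !avg_le // => xs /FG ->. Qed.

Lemma avgD T F G : avg T (fun xs => F xs + G xs) = avg T F + avg T G.
Proof. by elim: T F G => [|T IH] F G //=; rewrite !IH; field. Qed.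

Lemma avgZ T a F : avg T (fun xs => a * F xs) = a * avg T F.
Proof. by elim: T F => [|T IH] F //=; rewrite !IH; field. Qed.

Lemma avg_cst T a : avg T (fun=> a) = a.
Proof. by elim: T => [|T IH] //=; rewrite !IH; field. Qed.

Lemma avg_sum T (I : Type) (r : seq I) (P : pred I) (F : I -> seq bool -> R) :
  avg T (fun xs => \sum_(i <- r | P i) F i xs) = \sum_(i <- r | P i) avg T (F i).
Proof.
elim: r => [|i r IH]; first by under eq_avg do rewrite big_nil; rewrite avg_cst big_nil.
under eq_avg do rewrite big_cons.
by rewrite big_cons; case: (P i); rewrite ?avgD IH.
Qed.

Lemma avg_exists T F a : a <= avg T F -> exists2 xs, size xs = T & a <= F xs.
Proof.
elim: T F => [|T IH] F /= aF; first by exists [::].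
have [aF0|Fa0] := leP a (avg T (fun xs => F (false :: xs))).
  by have [xs sxs] := IH _ aF0; exists (false :: xs); rewrite //= sxs.
have [|xs sxs] := IH (fun xs => F (true :: xs)); first by lra.
by exists (true :: xs); rewrite //= sxs.
Qed.

Lemma avg_ge0 T F : (forall xs, 0 <= F xs) -> 0 <= avg T F.
Proof. by move=> F0; rewrite -[leLHS](avg_cst T); apply: avg_le => xs _. Qed.

Lemma sqr_avg_mul_le T F G : avg T (fun xs => F xs * G xs) ^+ 2 <=
  avg T (fun xs => F xs ^+ 2) * avg T (fun xs => G xs ^+ 2).
Proof.
apply: sqr_le_mul_of_quadratic_ge0 => [|t]; first by apply: avg_ge0 => xs; apply: sqr_ge0.
have : 0 <= avg T (fun xs => (F xs + t * G xs) ^+ 2) by apply: avg_ge0 => xs; apply: sqr_ge0.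
have -> : avg T (fun xs => (F xs + t * G xs) ^+ 2) =
    avg T (fun xs => F xs ^+ 2 + (2 * t * (F xs * G xs) + t ^+ 2 * G xs ^+ 2)).
  by apply: eq_avg => xs _; ring.
by rewrite !avgD !avgZ; congr (0 <= _); ring.
Qed.

Lemma sqr_avg_le T F : avg T F ^+ 2 <= avg T (fun xs => F xs ^+ 2).
Proof.
have := sqr_avg_mul_le T F (fun=> 1); under eq_avg do rewrite mulr1.
by rewrite expr1n avg_cst mulr1.
Qed.

Lemma exp2_avg_le T k F : avg T F ^+ (2 ^ k) <= avg T (fun xs => F xs ^+ (2 ^ k)).
Proof.
elim: k F => [|k IH] F; first by rewrite expr1.
rewrite expnS exprM; under [leRHS]eq_avg do rewrite exprM.
apply: le_trans (IH _); rewrite lerXn2r ?sqr_avg_le // nnegrE ?sqr_ge0 //.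
exact: le_trans (sqr_ge0 _) (sqr_avg_le _ _).
Qed.

Lemma avg_Paley_Zygmund T F : 0 <= avg T F ->
  avg T F ^+ 2 <= avg T (fun xs => F xs ^+ 2) * avg T (fun xs => (0 < F xs)%R%:R).
Proof.
move=> F0; pose G xs : R := (0 < F xs)%R%:R.
have -> : avg T G = avg T (fun xs => G xs ^+ 2).
  by apply: eq_avg => xs _; rewrite /G; case: ltP; rewrite /= ?expr1n ?expr0n.
apply: le_trans (sqr_avg_mul_le T F G).
have FG : avg T F <= avg T (fun xs => F xs * G xs).
  by apply: avg_le => xs _; rewrite /G; case: ltP => /= h; rewrite ?mulr1 ?mulr0.
by rewrite lerXn2r // nnegrE (le_trans F0).
Qed.

Fixpoint signed_sum c xs : R :=
  match c, xs with
  | a :: c', x :: xs' => (-1) ^+ x * a + signed_sum c' xs'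
  | _, _ => 0
  end.

Lemma avg_sqr_signed_sum c :
  avg (size c) (fun xs => signed_sum c xs ^+ 2) = \sum_(a <- c) a ^+ 2.
Proof.
elim: c => [|a c IH] /=; first by rewrite big_nil expr0n.
rewrite big_cons -IH -avgD mulrC -avgZ -[X in _ = X + _](avg_cst (size c)) -avgD.
by apply: eq_avg => xs _; field.
Qed.

Lemma avg_exp4_signed_sum_le c :
  avg (size c) (fun xs => signed_sum c xs ^+ 4) <= 3 * (\sum_(a <- c) a ^+ 2) ^+ 2.
Proof.
elim: c => [|a c IH] /=; first by rewrite big_nil !expr0n /= mulr0.
rewrite big_cons -avgD mulrC -avgZ.
have -> : avg (size c) (fun xs => 2^-1 * ((1 * a + signed_sum c xs) ^+ 4 +
      (-1 * a + signed_sum c xs) ^+ 4)) =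
    a ^+ 4 + 6 * a ^+ 2 * avg (size c) (fun xs => signed_sum c xs ^+ 2)
    + avg (size c) (fun xs => signed_sum c xs ^+ 4).
  rewrite -avgZ -{1}(avg_cst (size c) (a ^+ 4)) -!avgD.
  by apply: eq_avg => xs _; field.
by rewrite avg_sqr_signed_sum; have := sqr_ge0 (a ^+ 2); lra.
Qed.

Lemma signed_sumB (I : Type) (r : seq I) (f g : I -> R) xs :
  signed_sum [seq f i | i <- r] xs - signed_sum [seq g i | i <- r] xs =
  signed_sum [seq f i - g i | i <- r] xs.
Proof.
by elim: r xs => [|i r IH] [|x xs]; rewrite /= ?subr0 // -IH; ring.
Qed.

Definition sign_row d xs : 'rV[R]_d := \row_k (-1) ^+ nth false xs k.

Lemma signed_sum_enum d (f : 'I_d -> R) xs : size xs = d ->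
  signed_sum [seq f k | k <- enum 'I_d] xs = \sum_k f k * sign_row d xs 0 k.
Proof.
elim: d f xs => [|d IH] f xs; first by rewrite enum_ord0 /= big_ord0.
case: xs => [//|x xs] [sxs]; rewrite enum_ordSl big_ord_recl /= mxE mulrC; congr (_ + _).
by rewrite -map_comp IH //; apply: eq_bigr => k _; rewrite !mxE.
Qed.

End SignAverage.

(** * Tilts along a symmetric tripotent matrix *)

Section TripotentCalculus.
Variables (R : realFieldType) (m : nat).
Implicit Types A Y : 'M[R]_m.

(* The value at [A] of any function equal to [1] at [0], [p] at [1] and [q] at [-1]:
   these are the only possible eigenvalues of [A] when [A^3 = A]. *)
Definition tripotent_fun A (p q : R) : 'M[R]_m :=
  1 + ((p + q) / 2 - 1) *: A ^+ 2 + ((p - q) / 2) *: A.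

Lemma tripotent_funN A p q : tripotent_fun (- A) p q = tripotent_fun A q p.
Proof.
by rewrite /tripotent_fun sqrrN scalerN -scaleNr (addrC p) -mulNr opprB.
Qed.

Lemma tripotent_funM A p q p' q' : A ^+ 3 = A ->
  tripotent_fun A p q * tripotent_fun A p' q' = tripotent_fun A (p * p') (q * q').
Proof.
move=> A3; have A4 : A ^+ 2 * A ^+ 2 = A ^+ 2 by rewrite -exprD (exprSr A 3) A3 expr2.
rewrite /tripotent_fun -mulmxE !(mulmxDl, mulmxDr) -!(scalemxAl, scalemxAr).
rewrite !mul1mx !mulmx1 !mulmxE A4 -!expr2 -exprS -exprSr A3.
by move: (A ^+ 2) => P; apply/matrixP => i j; rewrite !mxE; field.
Qed.

Lemma tripotent_fun11 A : tripotent_fun A 1 1 = 1.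
Proof.
by rewrite /tripotent_fun; move: (A ^+ 2) => P; apply/matrixP => i j; rewrite !mxE; field.
Qed.

Lemma tripotent_funX A p q k : A ^+ 3 = A ->
  tripotent_fun A p q ^+ k = tripotent_fun A (p ^+ k) (q ^+ k).
Proof.
move=> A3; elim: k => [|k IH]; first by rewrite !expr0 tripotent_fun11.
by rewrite exprS IH tripotent_funM // -!exprS.
Qed.

Lemma tripotent_fun_sym A p q : A^T = A -> (tripotent_fun A p q)^T = tripotent_fun A p q.
Proof. by move=> sA; rewrite !linearD /= !linearZ /= trmx1 trmxX sA. Qed.

Lemma mxtrace_tripotent_fun_le A Y p q :
  0 <= \tr (Y * A ^+ 2) -> p + q <= 2 ->
  \tr (Y * tripotent_fun A p q) + \tr (Y * tripotent_fun A q p) <= 2 * \tr Y.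
Proof.
move=> YA0 pq; rewrite -mxtraceD -mulrDr.
have -> : tripotent_fun A p q + tripotent_fun A q p = 2 *: (1 : 'M_m) - (2 - (p + q)) *: A ^+ 2.
  by rewrite /tripotent_fun; move: (A ^+ 2) => P; apply/matrixP => i j; rewrite !mxE; field.
rewrite -mulmxE mulmxBr -!scalemxAr mulmx1 mulmxE raddfB /= !mxtraceZ.
by rewrite lerBlDr lerDl mulr_ge0 // subr_ge0.
Qed.

End TripotentCalculus.

Section ExponentialBounds.
Variable R : realType.
Implicit Types y lam : R.

Lemma expr1D_le_expR y k : (0 < k)%N -> - k%:R <= y ->
  (1 + y / k%:R) ^+ k <= expR y.
Proof.
move=> k0 yk; have k0' : (0 : R) < k%:R by rewrite ltr0n.
have -> : expR y = expR (y / k%:R) ^+ k.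
  by rewrite -expRM_natl mulrCA divff ?mulr1 ?gt_eqF.
rewrite lerXn2r // ?nnegrE ?expR_ge0 ?expR_ge1Dx //.
by rewrite -lerBlDl sub0r ler_pdivlMr // mulN1r.
Qed.

Lemma expR_le_quadratic y : y <= 1 / 2 -> expR y <= 1 + y + 2 * y ^+ 2.
Proof.
move=> y1; have y1' : 0 < 1 - y by lra.
have y_expR : (1 - y) * expR y <= 1.
  rewrite -[leRHS](expRxMexpNx_1 y) mulrC ler_wpM2l ?expR_ge0 //.
  exact: expR_ge1Dx.
rewrite -(ler_pM2l y1'); apply: le_trans y_expR _.
have : 0 <= y ^+ 2 * (1 - 2 * y) by rewrite mulr_ge0 ?sqr_ge0 //; lra.
lra.
Qed.

Lemma expR_drift_le lam : 0 <= lam <= 1 / 4 ->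
  expR (lam - 4 * lam ^+ 2) + expR (- lam - 4 * lam ^+ 2) <= 2.
Proof.
move=> /andP[l0 l1].
have l2 : 0 <= lam ^+ 2 by rewrite sqr_ge0.
have l4 : lam ^+ 2 * lam ^+ 2 <= 1 / 16 * lam ^+ 2.
  by rewrite ler_wpM2r //; nra.
have := @expR_le_quadratic (lam - 4 * lam ^+ 2).
have := @expR_le_quadratic (- lam - 4 * lam ^+ 2).
by move=> /(_ ltac:(lra)) + /(_ ltac:(lra)); lra.
Qed.

End ExponentialBounds.

Section Tilt.
Variables (R : realType) (m : nat).
Implicit Types A X Y Z : 'M[R]_m.

Definition tilt (h : R) X : 'M[R]_m := 1 + (h / 2) *: X.

Lemma tilt0 X : tilt 0 X = 1.
Proof. by rewrite /tilt mul0r scale0r addr0. Qed.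

Lemma tilt_sym h X : X^T = X -> (tilt h X)^T = tilt h X.
Proof. by move=> sX; rewrite linearD linearZ /= trmx1 sX. Qed.

Definition tilted_trace k X Z : R :=
  let G := tilt (2 ^ k)%:R^-1 X in \tr ((G * Z * G) ^+ (2 ^ k)).

Definition trace_contracting X Y : Prop :=
  forall k Z, (0 < k)%N -> Z^T = Z ->
    (tilted_trace k X Z + tilted_trace k Y Z) / 2 <= \tr (Z ^+ (2 ^ k)).

(* The second-order term compensates the convexity of the exponential. *)
Definition drift (lam : R) A : 'M[R]_m := lam *: A - (4 * lam ^+ 2) *: A ^+ 2.

Lemma drift_sym lam A : A^T = A -> (drift lam A)^T = drift lam A.
Proof. by move=> sA; rewrite /drift linearB !linearZ /= trmxX sA. Qed.

Lemma tilt_drift h lam A : tilt h (drift lam A) =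
  tripotent_fun A (1 + h / 2 * (lam - 4 * lam ^+ 2)) (1 + h / 2 * (- lam - 4 * lam ^+ 2)).
Proof.
rewrite /tilt /drift /tripotent_fun; move: (A ^+ 2) => P.
by apply/matrixP => i j; rewrite !mxE; field.
Qed.

Lemma drift_contracting lam A : 0 <= lam <= 1 / 4 -> A^T = A -> A ^+ 3 = A ->
  trace_contracting (drift lam A) (drift lam (- A)).
Proof.
move=> lam_bound sA A3 [//|k] Z _ sZ; rewrite /tilted_trace.
set N := (2 ^ k.+1)%N; set h := _^-1.
have [l0 l1] := andP lam_bound.
have N0 : (0 < 2 * N)%N by rewrite muln_gt0 expn_gt0.
have N1 : 1 <= (2 * N)%:R :> R by rewrite ler1n.
set p := 1 + (lam - 4 * lam ^+ 2) / (2 * N)%:R.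
set q := 1 + (- lam - 4 * lam ^+ 2) / (2 * N)%:R.
have tiltE : tilt h (drift lam A) = tripotent_fun A p q.
  by rewrite tilt_drift /p /q natrM invfM !(mulrC (_ - _)) [h / 2]mulrC.
have tiltNE : tilt h (drift lam (- A)) = tripotent_fun A q p.
  by rewrite tilt_drift tripotent_funN /p /q natrM invfM !(mulrC (_ - _)) [h / 2]mulrC.
rewrite tiltE tiltNE ler_pdivrMr // mulrC.
have sG r s : (tripotent_fun A r s)^T = tripotent_fun A r s by apply: tripotent_fun_sym.
have conj_le r s := mxtrace_conj_exp2_le k.+1 sZ (sG r s).
apply: le_trans (lerD (conj_le _ _) (conj_le _ _)) _.
rewrite !tripotent_funX // mxtrace_tripotent_fun_le //.
  have := mxtrace_gram_ge0 (A * Z ^+ (2 ^ k)).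
  rewrite trmxM trmxX sZ sA -mulrA mxtraceMC -!mulrA mulrA -expr2.
  by rewrite -exprD addnn -mul2n -expnS.
have l2 : lam ^+ 2 <= 1 / 4 * lam by rewrite expr2 ler_wpM2r.
apply: le_trans (lerD _ _) (expR_drift_le lam_bound); apply: expr1D_le_expR => //; lra.
Qed.

End Tilt.

(** * Differentiating a tilted product at the identity *)

Section MatrixDerivative.
Variables (R : realFieldType) (V : normedModType R).

Lemma is_derive_mxP m n (M : V -> 'M[R]_(m, n)) (t v : V) (dM : 'M[R]_(m, n)) :
  is_derive t v M dM <-> forall i j, is_derive t v (fun x => M x i j) (dM i j).
Proof.
split=> [[/[dup] dvM /derivable_mxP dvMij <-] i j|dMij].
  by rewrite derive_mx // mxE; apply: derivableP.
have dvM : derivable M t v by apply/derivable_mxP => i j; case: (dMij i j).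
apply: DeriveDef => //; rewrite derive_mx //; apply/matrixP => i j.
by rewrite mxE; case: (dMij i j).
Qed.

Lemma is_derive_mulmx m n p (A : V -> 'M[R]_(m, n)) (B : V -> 'M[R]_(n, p)) t v dA dB :
  is_derive t v A dA -> is_derive t v B dB ->
  is_derive t v (fun x => A x *m B x) (dA *m B t + A t *m dB).
Proof.
move=> /is_derive_mxP dAij /is_derive_mxP dBij; apply/is_derive_mxP => i j.
have -> : (fun x => (A x *m B x) i j) =
    \sum_k ((fun x => A x i k) * (fun x => B x k j) : V -> R).
  by apply/funext => x; rewrite mxE fct_sumE.
apply: is_derive_eq; rewrite !mxE -big_split; apply: eq_bigr => k _ /=.
by rewrite addrC; congr (_ + _); rewrite /GRing.scale /= mulrC.
Qed.

End MatrixDerivative.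

Lemma is_derive_dotp (R : realType) (V : normedModType R) m (u w : V -> 'rV[R]_m) t v du dw :
  is_derive t v u du -> is_derive t v w dw ->
  is_derive t v (fun x => dotp (u x) (w x)) (dotp du (w t) + dotp (u t) dw).
Proof.
move=> dut dwt; have dwT : is_derive t v (fun x => (w x)^T) dw^T.
  apply/is_derive_mxP => i j; rewrite mxE; under eq_fun do rewrite mxE.
  by move/is_derive_mxP: dwt; apply.
have /is_derive_mxP/(_ 0 0) := is_derive_mulmx dut dwT.
by under eq_fun do rewrite -dotpE; rewrite mxE -!dotpE.
Qed.

Lemma is_derive_avg (R : realType) T (F : R -> seq bool -> R) dF (t : R) :
  (forall xs, is_derive t (1 : R) (F^~ xs) (dF xs)) ->
  is_derive t (1 : R) (fun x => avg T (F x)) (avg T dF).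
Proof.
elim: T F dF => [|T IH] F dF hF //=.
pose Fb b x := avg T (fun xs => F x (b :: xs)).
have dFb b : is_derive t (1 : R) (Fb b) (avg T (fun xs => dF (b :: xs))) by apply: IH.
rewrite (_ : (fun x => _) = 2^-1 *: (Fb false + Fb true)).
  by apply: is_derive_eq; rewrite [_ / 2]mulrC.
by apply/funext => x /=; rewrite mulrC.
Qed.

(* [N ln F(1/N)] tends to the logarithmic derivative of [F] at [0]. *)
Lemma derive0_le_ln (R : realType) (F : R -> R) (D L : R) :
  is_derive (0 : R) (1 : R) F D -> F 0 = 1 ->
  (forall k, (0 < k)%N -> F (2 ^ k)%:R^-1 ^+ (2 ^ k) <= L) -> D <= ln L.
Proof.
move=> dF F0 FL.
have dlnF : is_derive (0 : R) (1 : R) (@ln R \o F) D.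
  rewrite -[D]mul1r; apply: is_derive1_comp => //.
  by rewrite F0 -[X in is_derive _ _ _ X]invr1; apply: is_derive1_ln.
have quotient_cvg : h^-1 *: ((@ln R \o F) (h *: 1 + 0) - (@ln R \o F) 0) @[h --> 0^'] --> D.
  by case: dlnF => [/cvg_ex[l hl] <-]; rewrite /derive (cvg_lim _ hl).
pose u (k : nat) : R := (2 ^ k.+1)%:R^-1.
have u_cvg : u k @[k --> \oo] --> (0 : R).
  rewrite (_ : u = fun k => 2^-1 ^+ k.+1); last by apply/funext => k; rewrite /u natrX exprVn.
  rewrite (cvg_shiftS (fun k => 2^-1 ^+ k : R)); apply: cvg_expr.
  by rewrite ger0_norm; lra.
have F_cvg : F (u k) @[k --> \oo] --> (1 : R).
  rewrite -F0; apply: continuous_cvg u_cvg.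
  by apply/differentiable_continuous/derivable1_diffP; case: dF.
have /cvgr_to_le : (u k)^-1 *: ((@ln R \o F) (u k *: 1 + 0) - (@ln R \o F) 0) @[k --> \oo] --> D.
  move/cvgr_dnbhsP: quotient_cvg; apply; split=> // k.
  by rewrite invr_neq0 // pnatr_eq0 expn_eq0.
apply; near=> k.
have Fk_gt0 : 0 < F (u k) by near: k; apply: cvgr_gt F_cvg _ ltr01.
rewrite /= F0 ln1 subr0 addr0 invrK [_%:A]mulr1 /GRing.scale /= mulr_natl -lnXn //.
rewrite ler_ln ?posrE ?exprn_gt0 ?FL //; exact: lt_le_trans (exprn_gt0 _ Fk_gt0) (FL k.+1 _).
Unshelve. all: end_near. Qed.

Section TiltedWalk.
Variables (R : realType) (m : nat) (I : Type).
Variables (H O : I -> bool -> 'M[R]_m) (e : 'rV[R]_m).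
Hypothesis H_sym : forall i x, (H i x)^T = H i x.
Hypothesis H_contracting : forall i, trace_contracting (H i false) (H i true).
Hypothesis O_orth : forall i x, O i x *m (O i x)^T = 1%:M.

Fixpoint walk (h : R) (l : seq I) (xs : seq bool) : 'M[R]_m :=
  match l, xs with
  | i :: l', x :: xs' => walk h l' xs' * O i x * tilt h (H i x)
  | _, _ => 1
  end.

Fixpoint gain (l : seq I) (xs : seq bool) : R :=
  match l, xs with
  | i :: l', x :: xs' => quad (H i x) (e *m walk 0 l' xs' *m O i x) + gain l' xs'
  | _, _ => 0
  end.

Lemma avg_trace_walk_le k l (Z : 'M[R]_m) : (0 < k)%N -> Z^T = Z ->
  avg (size l) (fun xs => let W := walk (2 ^ k)%:R^-1 l xs in \tr ((W * Z * W^T) ^+ (2 ^ k)))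
  <= \tr (Z ^+ (2 ^ k)).
Proof.
move=> k0; elim: l Z => [|i l IH] Z sZ /=; first by rewrite trmx1 mul1r mulr1.
apply: le_trans (H_contracting i k0 sZ); rewrite ler_pM2r ?invr_gt0 // /tilted_trace.
suff step x : avg (size l) (fun xs => let W := walk (2 ^ k)%:R^-1 (i :: l) (x :: xs) in
      \tr ((W * Z * W^T) ^+ (2 ^ k))) <= tilted_trace k (H i x) Z by apply: lerD; apply: step.
rewrite /tilted_trace /=; set G := tilt _ (H i x).
have sG : G^T = G by apply: tilt_sym.
have -> : \tr ((G * Z * G) ^+ (2 ^ k)) = \tr ((O i x * (G * Z * G) * (O i x)^T) ^+ (2 ^ k)).
  have OO : (O i x)^T * O i x = 1 := mulmx1C (O_orth i x).
  by rewrite [RHS]mxtrace_mulX (mulrA (O i x)^T) OO mul1r.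
apply: le_trans (IH _ _); last by rewrite !trmxM trmxK sZ sG !mulrA.
by apply: avg_le => xs _ /=; rewrite !trmxM sG !mulrA.
Qed.

Lemma dotp_walk0 l xs : dotp (e *m walk 0 l xs) (e *m walk 0 l xs) = dotp e e.
Proof.
elim: l xs => [|i l IH] [|x xs] /=; rewrite ?mulmx1 //.
by rewrite tilt0 mulr1 -mulmxE mulmxA dotp_mulmx -mulmxA O_orth mulmx1 IH.
Qed.

Lemma is_derive_tilt (X : 'M[R]_m) :
  is_derive (0 : R) (1 : R) (fun h : R => tilt h X) (2^-1 *: X).
Proof.
apply/is_derive_mxP => i j; rewrite mxE.
have := is_deriveD (is_derive_cst ((1 : 'M[R]_m) i j) (0 : R) (1 : R))
  (is_deriveZ (2^-1 * X i j) (is_derive_id (0 : R) (1 : R))).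
rewrite add0r [_ *: 1]mulr1; congr is_derive; apply/funext => h.
by rewrite !mxE !fctE /= /GRing.scale /=; ring.
Qed.

Lemma is_derive_walk l xs :
  exists2 de, is_derive (0 : R) (1 : R) (fun h => e *m walk h l xs) de &
    2 * dotp de (e *m walk 0 l xs) = gain l xs.
Proof.
have base : exists2 de, is_derive (0 : R) (1 : R) (fun h : R => e *m 1) de &
    2 * dotp de (e *m 1) = 0.
  exists 0; first exact: is_derive_cst.
  by rewrite -(scale0r 0) dotpZl mul0r mulr0.
elim: l xs => [|i l IH] [|x xs] //=.
have [ds dsP gainP] := IH xs; set s0 := e *m walk 0 l xs in gainP *.
have dO := is_derive_cst (O i x) (0 : R) (1 : R).
have := is_derive_mulmx (is_derive_mulmx dsP dO) (is_derive_tilt (H i x)).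
rewrite mulmx0 addr0 tilt0 mulmx1 -/s0 -scalemxAr => dP; eexists.
  rewrite (_ : (fun h => _) = fun h => e *m walk h l xs *m O i x *m tilt h (H i x)).
    exact: dP.
  by apply/funext => h; rewrite -!mulmxE !mulmxA.
rewrite mulr1 -mulmxE mulmxA -/s0 dotpDl dotpZl dotp_mulmx -mulmxA.
by rewrite O_orth mulmx1 mulrDr gainP /quad /=; field.
Qed.

Hypothesis e_gt0 : 0 < dotp e e.

Lemma avg_gain_le l : (0 < m)%N -> avg (size l) (gain l) <= dotp e e * ln m%:R.
Proof.
move=> m0; rewrite -ler_pdivrMl //.
pose F h := avg (size l) (fun xs =>
  (dotp e e)^-1 * dotp (e *m walk h l xs) (e *m walk h l xs)).
have dF : is_derive (0 : R) (1 : R) F (avg (size l) (fun xs => (dotp e e)^-1 * gain l xs)).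
  apply: is_derive_avg => xs; have [de deP <-] := is_derive_walk l xs.
  by rewrite mulrDl mul1r {2}dotpC; apply: is_deriveZ; apply: is_derive_dotp.
rewrite -avgZ; apply: derive0_le_ln dF _ _.
  rewrite /F -[RHS](avg_cst (size l)); apply: eq_avg => xs _.
  by rewrite dotp_walk0 mulVf // gt_eqF.
move=> k k0; apply: le_trans (exp2_avg_le _ _ _) _.
have := avg_trace_walk_le l k0 (trmx1 R m); rewrite expr1n mxtrace1 /=.
apply: le_trans; apply: avg_le => xs _; set W := walk _ _ _.
rewrite mulr1 exprMn exprVn ler_pdivrMl ?exprn_gt0 //.
have -> : dotp (e *m W) (e *m W) = quad (W * W^T) e.
  by rewrite /quad -mulmxE mulmxA dotpC dotp_mulmx dotpC.
by apply: quad_exp2_trace_le => //; rewrite trmxM trmxK.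
Qed.

End TiltedWalk.

(** * Phases *)

Section TrigoBounds.
Variable R : realType.
Implicit Types x : R.

Lemma sin_MVT x : 0 < x -> exists2 y, 0 < y < x & sin x = cos y * x.
Proof.
move=> x0; have [|y] := @MVT R sin cos 0 x x0 (fun y _ => is_derive_sin y).
  exact/continuous_subspaceT/continuous_sin.
by rewrite in_itv /= sin0 !subr0 => y0x E; exists y.
Qed.

Lemma sqr_sin_le x : sin x ^+ 2 <= x ^+ 2.
Proof.
wlog x0 : x / 0 <= x.
  move=> h; have [/h //|x0] := leP 0 x.
  by rewrite -sqrrN -sinN -[leRHS]sqrrN; apply: h; lra.
move: x0; rewrite le0r => /predU1P[->|x0]; first by rewrite sin0.
have [y _ ->] := sin_MVT x0.
by rewrite exprMn ler_piMl ?sqr_ge0 // cos2sin2 lerBlDr lerDl sqr_ge0.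
Qed.

Lemma cos_ge1Bsqr x : 1 - x ^+ 2 / 2 <= cos x.
Proof.
have -> : x = (x / 2) *+ 2 by rewrite -mulr_natr; field.
by rewrite cos_mulr2n cos2sin2; have := sqr_sin_le (x / 2); lra.
Qed.

Lemma sin_ge_half x : 0 <= x <= 1 -> x / 2 <= sin x.
Proof.
move=> /andP[]; rewrite le0r => /predU1P[-> _|x0 x1]; first by rewrite sin0 mul0r.
have [y /andP[y0 yx] ->] := sin_MVT x0.
by rewrite mulrC ler_pM2r //; apply: le_trans (cos_ge1Bsqr y); nra.
Qed.

Lemma prod_cos_ge (r : seq R) : \sum_(x <- r) x ^+ 2 <= 2 ->
  1 - (\sum_(x <- r) x ^+ 2) / 2 <= \prod_(x <- r) cos x.
Proof.
move=> hr; suff /(_ hr)/andP[] : \sum_(x <- r) x ^+ 2 <= 2 ->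
  1 - (\sum_(x <- r) x ^+ 2) / 2 <= \prod_(x <- r) cos x <= 1 by [].
elim: r {hr} => [|x r IH]; first by rewrite !big_nil; lra.
rewrite !big_cons; have := cos_ge1Bsqr x; have := cos_le1 x.
have S0 : 0 <= \sum_(y <- r) y ^+ 2 by rewrite sumr_ge0 // => y _; rewrite sqr_ge0.
move=> c1 c2 xr; have x0 := sqr_ge0 x.
have /IH/andP[] : \sum_(y <- r) y ^+ 2 <= 2 by lra.
set S := \sum_(y <- r) _ in S0 xr *; set P := \prod_(y <- r) _ => P1 P2.
apply/andP; split; last by nra.
apply: le_trans (_ : (1 - x ^+ 2 / 2) * (1 - S / 2) <= _); first by nra.
by apply: ler_pM => //; lra.
Qed.

Lemma avg_cos_signed_sum (r : seq R) :
  avg (size r) (fun xs => cos (signed_sum r xs)) = \prod_(x <- r) cos x.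
Proof.
elim: r => [|x r IH] /=; first by rewrite big_nil cos0.
rewrite big_cons -IH -avgD -avgZ mulrC -avgZ; apply: eq_avg => xs _.
by rewrite mul1r mulN1r !cosD cosN sinN; field.
Qed.

End TrigoBounds.

Section CircleStates.
Variables (R : realType) (n : nat).
Implicit Types (phi psi : 'I_n -> R).

Definition circ psi : 'rV[R]_(n + n) := row_mx (\row_a cos (psi a)) (\row_a sin (psi a)).

Definition rotmx psi : 'M[R]_(n + n) :=
  block_mx (diag_mx (\row_a cos (psi a))) (diag_mx (\row_a sin (psi a)))
           (- diag_mx (\row_a sin (psi a))) (diag_mx (\row_a cos (psi a))).

Lemma dotp_row_mx m p (u u' : 'rV[R]_m) (v v' : 'rV[R]_p) :
  dotp (row_mx u v) (row_mx u' v') = dotp u u' + dotp v v'.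
Proof. by rewrite !dotpE tr_row_mx mul_row_col mxE. Qed.

Lemma dotp_circ psi : dotp (circ psi) (circ psi) = n%:R.
Proof.
rewrite dotp_row_mx -big_split /=.
under eq_bigr do rewrite !mxE -!expr2 cos2Dsin2.
by rewrite sumr_const card_ord.
Qed.

Lemma circ_rotmx phi psi : circ phi *m rotmx psi = circ (fun a => psi a + phi a).
Proof.
rewrite /rotmx /circ mul_row_block mulmxN !mul_mx_diag.
by congr row_mx; apply/rowP => a; rewrite !mxE ?cosD ?sinD; ring.
Qed.

Lemma rotmx_orth psi : rotmx psi *m (rotmx psi)^T = 1%:M.
Proof.
rewrite /rotmx tr_block_mx !linearN /= !tr_diag_mx mulmx_block.
rewrite !mulNmx !mulmxN !mulmx_diag opprK (scalar_mx_block n n).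
by congr block_mx; apply/matrixP => i j; rewrite !mxE; case: eqP => _ /=;
  rewrite ?mulr0n ?mulr1n ?oppr0 ?addr0 // -?expr2 ?cos2Dsin2 // 1?addrC ?cos2Dsin2 //; ring.
Qed.

Variables (pr : 'I_n -> 'I_n) (sg : 'I_n -> R).
Hypothesis prK : involutive pr.
Hypothesis sgN : forall a, sg (pr a) = - sg a.

Definition pairing_mx : 'M[R]_n := \matrix_(a, b) (sg a * (b == pr a)%:R).

Definition matching_mx : 'M[R]_(n + n) := block_mx 0 (- pairing_mx) pairing_mx 0.

Lemma pairing_mx_tr : pairing_mx^T = - pairing_mx.
Proof.
apply/matrixP => a b; rewrite !mxE; have [->|ba] := eqVneq b (pr a).
  by rewrite prK !eqxx sgN !mulr1.
by rewrite -(inj_eq (inv_inj prK)) prK eq_sym (negbTE ba) !mulr0 oppr0.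
Qed.

Lemma mul_pairing_mx p (A : 'M[R]_(p, n)) :
  A *m pairing_mx = \matrix_(i, a) (- (sg a * A i (pr a))).
Proof.
rewrite -[pairing_mx]trmxK pairing_mx_tr linearN mulmxN /=.
apply/matrixP => i a; rewrite !mxE (bigD1 (pr a)) //= !mxE eqxx mulr1 big1.
  by rewrite addr0 mulrC.
by move=> b /negbTE ba; rewrite !mxE ba !mulr0.
Qed.

Lemma matching_mx_sym : matching_mx^T = matching_mx.
Proof. by rewrite /matching_mx tr_block_mx !trmx0 linearN /= pairing_mx_tr opprK. Qed.

Lemma circ_matching_mx psi : circ psi *m matching_mx =
  row_mx (\row_a (- (sg a * sin (psi (pr a))))) (\row_a (sg a * cos (psi (pr a)))).
Proof.
rewrite mul_row_block !mulmx0 add0r addr0 mulmxN !mul_pairing_mx.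
by congr row_mx; apply/rowP => a; rewrite !mxE ?opprK.
Qed.

Lemma quad_matching_mx psi :
  quad matching_mx (circ psi) = \sum_a sg a * sin (psi a - psi (pr a)).
Proof.
rewrite /quad circ_matching_mx dotp_row_mx -big_split /=.
by apply: eq_bigr => a _; rewrite !mxE sinB; ring.
Qed.

Lemma quad_sqr_matching_mx psi :
  quad (matching_mx ^+ 2) (circ psi) = \sum_a sg a ^+ 2.
Proof.
rewrite expr2 quad_sqr ?matching_mx_sym // circ_matching_mx dotp_row_mx -big_split /=.
apply: eq_bigr => a _; rewrite !mxE mulrNN -!expr2 !exprMn -mulrDr addrC cos2Dsin2.
by rewrite mulr1.
Qed.

Hypothesis sg3 : forall a, sg a ^+ 3 = sg a.

Lemma matching_mx_exp3 : matching_mx ^+ 3 = matching_mx.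
Proof.
have pairing3 : pairing_mx *m pairing_mx *m pairing_mx = - pairing_mx.
  rewrite !mul_pairing_mx; apply/matrixP => i a; rewrite !mxE !prK.
  have [->|_] := eqVneq a (pr i); last by rewrite !(mulr0, oppr0).
  by rewrite prK sgN -[in RHS](sg3 i); ring.
rewrite !exprS expr0 mulr1 -!mulmxE /matching_mx !mulmx_block.
by rewrite !(mul0mx, mulmx0, add0r, addr0, mulNmx, mulmxN, oppr0) !mulmxA pairing3 !opprK.
Qed.

End CircleStates.

Lemma matching_mxZ (R : realType) n (pr : 'I_n -> 'I_n) (sg : 'I_n -> R) (x : R) :
  x *: matching_mx pr sg = matching_mx pr (fun a => x * sg a).
Proof.
have pairing_mxZ : x *: pairing_mx pr sg = pairing_mx pr (fun a => x * sg a).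
  by apply/matrixP => a b; rewrite !mxE mulrA.
by rewrite /matching_mx scale_block_mx scalerN !pairing_mxZ !scaler0.
Qed.

Lemma quad_drift (R : realType) m (lam : R) (A : 'M[R]_m) u :
  quad (drift lam A) u = lam * quad A u - 4 * lam ^+ 2 * quad (A ^+ 2) u.
Proof. by rewrite /quad /drift mulmxBr -!scalemxAr !dotp_lin. Qed.

Section SignDecoding.
Variables (R : realType) (n : nat) (I : Type).
Variables (pr : I -> 'I_n -> 'I_n) (sg phi : I -> 'I_n -> R).
Hypothesis prK : forall i, involutive (pr i).
Hypothesis sgN : forall i a, sg i (pr i a) = - sg i a.
Hypothesis sg3 : forall i a, sg i a ^+ 3 = sg i a.
Implicit Types (lam eps : R) (l : seq I) (xs : seq bool).

Let H lam i (x : bool) := drift lam ((-1) ^+ x *: matching_mx (pr i) (sg i)).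
Let O i (x : bool) := rotmx (fun a => (-1) ^+ x * phi i a).
Let e : 'rV[R]_(n + n) := circ (fun=> 0).
Let phase l xs a := signed_sum [seq phi i a | i <- l] xs.
Let dphi i j a := phi j a - phi j (pr i a).

Let walk_circ lam l xs : e *m walk (H lam) O 0 l xs = circ (phase l xs).
Proof.
elim: l xs => [|i l IH] [|x xs] /=; rewrite ?mulmx1 //.
by rewrite tilt0 mulr1 -mulmxE mulmxA IH circ_rotmx.
Qed.

Let quad_step lam i (x : bool) psi :
  quad (H lam i x) (circ psi *m O i x) = \sum_a
    (lam * sg i a * ((-1) ^+ x * sin ((-1) ^+ x * dphi i i a + (psi a - psi (pr i a))))
     - 4 * lam ^+ 2 * sg i a ^+ 2).
Proof.
have sgNx a : (-1) ^+ x * sg i (pr i a) = - ((-1) ^+ x * sg i a) by rewrite sgN mulrN.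
rewrite /H matching_mxZ circ_rotmx quad_drift.
rewrite (quad_matching_mx (prK i) sgNx) (quad_sqr_matching_mx (prK i) sgNx).
rewrite sumrB -!mulr_sumr; congr (_ - _); last first.
  by congr (_ * _); apply: eq_bigr => a _; rewrite exprMn sqrr_sign mul1r.
rewrite mulr_sumr; apply: eq_bigr => a _; rewrite -!mulrA; congr (_ * _).
rewrite mulrCA; congr (_ * (_ * sin _)); rewrite /dphi; ring.
Qed.

Lemma avg_gain_cons lam i l :
  avg (size (i :: l)) (gain (H lam) O e (i :: l)) =
  \sum_a (lam * (sg i a * sin (dphi i i a) * \prod_(j <- l) cos (dphi i j a))
          - 4 * lam ^+ 2 * sg i a ^+ 2)
  + avg (size l) (gain (H lam) O e l).
Proof.
have sin_half (x y : R) : 2^-1 * (sin (x + y) - sin (- x + y)) = sin x * cos y.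
  by rewrite !sinD cosN sinN; field.
have step xs : 2^-1 * (gain (H lam) O e (i :: l) (false :: xs) +
      gain (H lam) O e (i :: l) (true :: xs)) =
    \sum_a (lam * (sg i a * sin (dphi i i a)) * cos (signed_sum [seq dphi i j a | j <- l] xs)
            - 4 * lam ^+ 2 * sg i a ^+ 2) + gain (H lam) O e l xs.
  rewrite /= walk_circ !quad_step addrACA -big_split mulrDr mulr_sumr /=.
  congr (_ + _); last by field.
  apply: eq_bigr => a _; rewrite signed_sumB -[_ * cos _]mulrA -[_ * cos _]mulrA -sin_half.
  by rewrite !mul1r !mulN1r; field.
rewrite /= -avgD mulrC -avgZ (eq_avg (fun xs _ => step xs)) avgD avg_sum; congr (_ + _).
apply: eq_bigr => a _; rewrite avgD avg_cst avgZ.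
have := avg_cos_signed_sum [seq dphi i j a | j <- l].
by rewrite size_map big_map => ->; rewrite -!mulrA.
Qed.

(* Once the signs of the steps preceding [i] are known, what is left of the phase
   difference of a pair matched by [i] is correlated with the sign of step [i]. *)
Fixpoint decodable eps l : Prop :=
  if l is i :: l' then
    (forall a, sg i a != 0 ->
       eps <= sg i a * sin (dphi i i a) * \prod_(j <- l') cos (dphi i j a))
    /\ decodable eps l'
  else True.

Lemma sum_sg_le_avg_gain lam eps l : 0 <= lam -> decodable eps l ->
  (lam * eps - 4 * lam ^+ 2) * \sum_(i <- l) \sum_a sg i a ^+ 2 <=
  avg (size l) (gain (H lam) O e l).
Proof.
move=> lam0; elim: l => [_|i l IH [hi hl]]; first by rewrite big_nil mulr0.
rewrite big_cons mulrDr avg_gain_cons lerD ?IH // mulr_sumr; apply: ler_sum => a _.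
have [->|s0] := eqVneq (sg i a) 0; first by rewrite expr0n !mul0r !mulr0 subr0.
have -> : sg i a ^+ 2 = 1 by apply: (mulfI s0); rewrite -exprS sg3 mulr1.
by rewrite !mulr1 lerD2r ler_wpM2l // hi.
Qed.

Lemma sum_sqr_sg_le eps l : (0 < n)%N -> 0 <= eps <= 1 -> decodable eps l ->
  eps ^+ 2 * \sum_(i <- l) \sum_a sg i a ^+ 2 <= 16 * n%:R * ln (n + n)%:R.
Proof.
move=> n0 /andP[e0 e1] /(@sum_sg_le_avg_gain (eps / 8)).
have -> : eps / 8 * eps - 4 * (eps / 8) ^+ 2 = eps ^+ 2 / 16 by field.
have lam_bound : 0 <= eps / 8 <= 1 / 4 by lra.
have contracting i : trace_contracting (H (eps / 8) i false) (H (eps / 8) i true).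
  rewrite /H expr0 expr1 scale1r scaleN1r; apply: drift_contracting => //.
    exact: matching_mx_sym.
  exact: matching_mx_exp3.
have H_sym i x : (H (eps / 8) i x)^T = H (eps / 8) i x.
  by apply: drift_sym; rewrite linearZ /= matching_mx_sym.
have := @avg_gain_le _ _ _ _ O e H_sym contracting (fun i x => rotmx_orth _) _ l.
rewrite dotp_circ ltr0n addn_gt0 n0 => /(_ isT isT) gain_le /(_ _) sg_le.
have := le_trans (sg_le _) gain_le; lra.
Qed.

End SignDecoding.

(** * Dyadic scales *)

Lemma sum_expr_tail_le (R : realFieldType) (x : R) s S : 0 <= x < 1 ->
  \sum_(t < S | (s <= t)%N) x ^+ t <= x ^+ s / (1 - x).
Proof.
move=> /andP[x0 x1]; have x1' : 0 < 1 - x by rewrite subr_gt0.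
rewrite -(big_geq_mkord _ _ xpredT (fun t => x ^+ t)).
have [sS|Ss] := leqP s S; last first.
  by rewrite big_geq ?(ltnW Ss) // divr_ge0 ?exprn_ge0 // ltW.
rewrite -(subnKC sS) geometric_partial_tail geometric_seriesE ?lt_eqF //=.
by rewrite ler_pM2r ?invr_gt0 // ler_piMr ?exprn_ge0 // lerBlDr lerDl exprn_ge0.
Qed.

Lemma ler_sum_uniq (R : numDomainType) (T : finType) (l : seq T) (P : pred T) (F : T -> R) :
  uniq l -> all P l -> (forall j, 0 <= F j) -> \sum_(j <- l) F j <= \sum_(j | P j) F j.
Proof.
move=> ul /allP lP F0; rewrite (big_uniq _ ul) /= big_mkcond [leRHS]big_mkcond /=.
by apply: ler_sum => j _; case: ifP => [/lP ->//|_]; case: ifP.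
Qed.

Lemma sgr_exp3 (R : realDomainType) (x : R) : Num.sg x ^+ 3 = Num.sg x.
Proof. by rewrite exprSr sqr_sg; case: sgrP; rewrite ?mulr0 ?mul1r. Qed.

Definition aligned (R : realType) d (kappa : R) (i : 'I_d) (u : 'rV[R]_d) : bool :=
  0 < dotp u u <= (kappa * u 0 i) ^+ 2.

Lemma alignedZ (R : realType) d (kappa c : R) (i : 'I_d) u : c != 0 ->
  aligned kappa i (c *: u) = aligned kappa i u.
Proof.
move=> c0; have c2 : 0 < c ^+ 2 by rewrite exprn_even_gt0.
have uu : dotp (c *: u) (c *: u) = c ^+ 2 * dotp u u by rewrite !dotp_lin mulrA expr2.
by rewrite /aligned uu mxE mulrCA exprMn pmulr_rgt0 // ler_pM2l.
Qed.

Lemma aligned_coord_itv (R : realType) d (kappa : R) (i : 'I_d) u s :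
  0 < kappa -> aligned kappa i u -> 4 ^+ s <= dotp u u < 4 ^+ s.+1 ->
  1 / (2 * kappa) <= 2^-1 ^+ s.+1 * `|u 0 i| <= 1.
Proof.
move=> k0 /andP[_ u_le] /andP[s_le lt_s]; set b := _ * `|_|.
have p0 : 0 < 4 ^+ s.+1 :> R by rewrite exprn_gt0.
have b2 : 4 ^+ s.+1 * b ^+ 2 = u 0 i ^+ 2.
  rewrite exprMn -exprM mulnC exprM real_normK ?num_real // mulrA -exprMn.
  by rewrite (_ : 4 * 2^-1 ^+ 2 = 1 :> R) ?expr1n ?mul1r //; field.
have b0 : 0 <= b by rewrite mulr_ge0 ?exprn_ge0 ?invr_ge0.
have ui_le : u 0 i ^+ 2 <= dotp u u.
  by rewrite -sum_sqr_dotp (bigD1 i) //= lerDl sumr_ge0 // => k _; rewrite sqr_ge0.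
apply/andP; split.
  have kb0 : 0 <= b * kappa := mulr_ge0 b0 (ltW k0).
  rewrite ler_pdivrMr ?mulr_gt0 // mulrCA mulrC -ler_pdivrMr //.
  rewrite -(@ler_pXn2r _ 2) ?nnegrE ?divr_ge0 // -(ler_pM2l p0).
  move: u_le s_le; rewrite exprMn -b2 !exprMn [4 ^+ s.+1]exprS.
  by move: (4 ^+ s) (dotp u u) => x z; lra.
suff : b ^+ 2 <= 1 by rewrite expr_le1.
rewrite -(ler_pM2l p0) b2 mulr1.
exact: le_trans ui_le (ltW lt_s).
Qed.

Lemma sum_sqr_dyadic_tail_le (R : realType) d S s (u : 'rV[R]_d) : dotp u u <= 4 ^+ s.+1 ->
  \sum_(j : 'I_S * 'I_d | (s <= j.1)%N) (2^-1 ^+ j.1.+1 * u 0 j.2) ^+ 2 <= 4 / 3.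
Proof.
move=> u_le; rewrite (eq_bigl (fun j : 'I_S * 'I_d => (s <= j.1)%N && true)); last first.
  by move=> j; rewrite andbT.
rewrite -(pair_big (fun t : 'I_S => (s <= t)%N) xpredT
   (fun (t : 'I_S) k => (2^-1 ^+ t.+1 * u 0 k) ^+ 2)) /=.
have level_sum t : \sum_k (2^-1 ^+ t.+1 * u 0 k) ^+ 2 = 4^-1 * dotp u u * 4^-1 ^+ t.
  rewrite -sum_sqr_dotp mulrAC -exprS mulr_sumr; apply: eq_bigr => k _.
  by rewrite exprMn -exprM mulnC exprM (_ : 2^-1 ^+ 2 = 4^-1 :> R) //; field.
under eq_bigr do rewrite level_sum.
rewrite -mulr_sumr; apply: le_trans (ler_wpM2l _ (sum_expr_tail_le _ _ _)) _.
- by rewrite mulr_ge0 ?invr_ge0 ?dotp_ge0.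
- by lra.
have : dotp u u * 4^-1 ^+ s <= 4 by rewrite exprVn ler_pdivrMr ?exprn_gt0 // -exprS.
have -> : 4^-1 * dotp u u * (4^-1 ^+ s / (1 - 4^-1)) = dotp u u * 4^-1 ^+ s / 3 by field.
by rewrite ler_pM2r ?invr_gt0.
Qed.

Lemma prod_cos_dyadic_ge (R : realType) d S s (u : 'rV[R]_d) (l : seq ('I_S * 'I_d)) :
  dotp u u <= 4 ^+ s.+1 -> uniq l -> all (fun k : 'I_S * 'I_d => s <= k.1)%N l ->
  1 / 3 <= \prod_(k <- l) cos (2^-1 ^+ k.1.+1 * u 0 k.2).
Proof.
move=> /(sum_sqr_dyadic_tail_le S) tail_le ul sl.
have := le_trans (ler_sum_uniq ul sl _) tail_le => /(_ (fun=> sqr_ge0 _)) {}tail_le.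
have := @prod_cos_ge R [seq 2^-1 ^+ k.1.+1 * u 0 k.2 | k : 'I_S * 'I_d <- l].
rewrite !big_map => cos_ge; apply: le_trans (cos_ge _); last by apply: le_trans tail_le _; lra.
by move: (\sum_(k <- l) _) tail_le => x; lra.
Qed.

Section DyadicScales.
Variables (R : realType) (n d : nat) (kappa : R).
Variables (w : 'I_n -> 'rV[R]_d) (pr : 'I_d -> 'I_n -> 'I_n).
Hypothesis prK : forall i, involutive (pr i).

Let gap i a := w a - w (pr i a).
Let gap_sqr i a := dotp (gap i a) (gap i a).
Let gap_aligned i a := aligned kappa i (gap i a).

Hypothesis kappa_ge1 : 1 <= kappa.
Hypothesis aligned_ge1 : forall i a, gap_aligned i a -> 1 <= gap_sqr i a.

Let gap_pr i a : gap i (pr i a) = (-1) *: gap i a.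
Proof. by rewrite /gap prK scaleN1r opprB. Qed.

Let gap_sqr_pr i a : gap_sqr i (pr i a) = gap_sqr i a.
Proof. by rewrite /gap_sqr gap_pr dotpZl dotpZr mulrA mulrNN !mul1r. Qed.

Let gap_sqr_le i a : gap_aligned i a -> gap_sqr i a <= (kappa * gap i a 0 i) ^+ 2.
Proof. by case/andP. Qed.

Definition pair_scale i a : nat := trunc_log 4 (Num.truncn (gap_sqr i a)).

Lemma pair_scale_itv i a : gap_aligned i a ->
  4 ^+ pair_scale i a <= gap_sqr i a < 4 ^+ (pair_scale i a).+1.
Proof.
move=> gia; have q1 := aligned_ge1 gia; rewrite -!natrX -truncn_ge_nat ?(le_trans ler01) //.
rewrite -truncn_lt_nat ?(le_trans ler01) // trunc_logP ?truncn_gt0 //.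
exact: trunc_log_ltn.
Qed.

Let S := (\max_i \max_a pair_scale i a).+1.
Let step := ('I_S * 'I_d)%type.

Definition step_active (j : step) a : bool := gap_aligned j.2 a && (pair_scale j.2 a == j.1).

Definition step_le (j k : step) : bool := (j.1 <= k.1)%N.

Definition step_partner (j : step) a : 'I_n := if step_active j a then pr j.2 a else a.

Definition step_sign (j : step) a : R := Num.sg (w a 0 j.2 - w (step_partner j a) 0 j.2).

Definition step_phase (j : step) a : R := 2^-1 ^+ j.1.+1 * w a 0 j.2.

Lemma step_partnerK j : involutive (step_partner j).
Proof.
move=> a; have act_pr : step_active j (pr j.2 a) = step_active j a.
  by rewrite /step_active /pair_scale gap_sqr_pr /gap_aligned gap_pr alignedZ ?oppr_eq0 ?oner_eq0.
by rewrite /step_partner; case act: (step_active j a); rewrite ?act_pr act ?prK.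
Qed.

Lemma step_signN j a : step_sign j (step_partner j a) = - step_sign j a.
Proof. by rewrite /step_sign step_partnerK -sgrN opprB. Qed.

Lemma step_sign_active j a : step_active j a ->
  step_sign j a = Num.sg (gap j.2 a 0 j.2) /\ gap j.2 a 0 j.2 != 0.
Proof.
move=> act; rewrite /step_sign /step_partner act !mxE; split=> //.
have /andP[ga _] := act; apply/eqP => y0; have := gap_sqr_le ga; have := aligned_ge1 ga.
by rewrite !mxE y0 mulr0 expr0n /=; lra.
Qed.

Lemma step_sin_ge j a : step_active j a ->
  1 / (4 * kappa) <= step_sign j a * sin (2^-1 ^+ j.1.+1 * gap j.2 a 0 j.2).
Proof.
move=> act; have [-> _] := step_sign_active act; have /andP[ga /eqP sj] := act.
have k0 : 0 < kappa := lt_le_trans ltr01 kappa_ge1.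
have := aligned_coord_itv k0 ga (pair_scale_itv ga).
rewrite -sin_sg mulrCA -normrEsg sj; set b := _ * `|_| => /andP[b_ge b_le].
have b0 : 0 <= b by apply: le_trans b_ge; rewrite divr_ge0 ?mulr_ge0 ?(ltW k0).
apply: le_trans (@sin_ge_half R b _); last by rewrite b0.
rewrite (_ : 1 / (4 * kappa) = 1 / (2 * kappa) / 2) ?ler_pM2r ?invr_gt0 //.
by field; rewrite gt_eqF.
Qed.

Lemma dyadic_steps_decodable (l : seq step) :
  uniq l -> sorted step_le l ->
  decodable step_partner step_sign step_phase (1 / (12 * kappa)) l.
Proof.
have k0 : 0 < kappa := lt_le_trans ltr01 kappa_ge1.
have -> : 1 / (12 * kappa) = 1 / (4 * kappa) * (1 / 3) by field; rewrite gt_eqF.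
elim: l => [//|j l IH] /= /andP[_ ul] jl; split; last by apply: IH => //; apply: path_sorted jl.
move=> a sg0; have act : step_active j a.
  by apply: contraR sg0; rewrite /step_sign /step_partner => /negbTE ->; rewrite subrr sgr0.
have /andP[ga /eqP sj] := act.
have dphi k : step_phase k a - step_phase k (step_partner j a) =
    2^-1 ^+ k.1.+1 * gap j.2 a 0 k.2.
  by rewrite /step_phase /step_partner act -mulrBr !mxE.
under eq_bigr do rewrite dphi; rewrite dphi.
have step_le_trans : transitive step_le by move=> ? ? ?; apply: leq_trans.
have /andP[_ /ltW] := pair_scale_itv ga; rewrite sj => q_le4.
have cos_ge := prod_cos_dyadic_ge q_le4 ul (order_path_min step_le_trans jl).
have sin_ge := step_sin_ge act.
by apply: ler_pM => //; rewrite divr_ge0 ?mulr_ge0 ?(ltW k0).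
Qed.

Lemma step_sign_scale i a : gap_aligned i a -> (1 : R) <= \sum_s step_sign (s, i) a ^+ 2.
Proof.
move=> ga; have sS : (pair_scale i a < S)%N.
  by rewrite ltnS (leq_trans _ (leq_bigmax i)) //; apply: (leq_bigmax a).
have act : step_active (Ordinal sS, i) a by rewrite /step_active ga /=.
rewrite (bigD1 (Ordinal sS)) //=; have [-> y0] := step_sign_active act.
by rewrite sqr_sg y0 lerDl sumr_ge0 // => s _; rewrite sqr_ge0.
Qed.

Lemma sum_aligned_ge1_le : (0 < n)%N ->
  (\sum_i \sum_a gap_aligned i a)%:R <= (48 * kappa) ^+ 2 * n%:R * ln (n + n)%:R :> R.
Proof.
move=> n0; have k0 : 0 < kappa := lt_le_trans ltr01 kappa_ge1.
pose l := sort step_le (enum {: step}).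
have sg3 j a : step_sign j a ^+ 3 = step_sign j a := sgr_exp3 _.
have eps_bound : 0 <= 1 / (12 * kappa) <= 1.
  rewrite divr_ge0 ?mulr_ge0 ?(ltW k0) //= ler_pdivrMr ?mulr_gt0 // mul1r.
  by rewrite -[leLHS]mulr1 ler_pM // ler1n.
have uniq_l : uniq l by rewrite sort_uniq enum_uniq.
have sorted_l : sorted step_le l by apply: sort_sorted => j k; apply: leq_total.
have := sum_sqr_sg_le step_partnerK step_signN sg3 n0 eps_bound
  (dyadic_steps_decodable uniq_l sorted_l).
have -> : \sum_(j <- l) \sum_a step_sign j a ^+ 2 =
    \sum_i \sum_a \sum_s step_sign (s, i) a ^+ 2.
  rewrite (perm_big (enum {: step})) /=; last by rewrite perm_sort.
  rewrite big_enum /= -(pair_big xpredT xpredT (fun s i => \sum_a step_sign (s, i) a ^+ 2)).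
  by rewrite exchange_big; apply: eq_bigr => i _; rewrite exchange_big.
have count_le : (\sum_i \sum_a gap_aligned i a)%:R <= \sum_i \sum_a \sum_s step_sign (s, i) a ^+ 2.
  rewrite natr_sum; apply: ler_sum => i _; rewrite natr_sum; apply: ler_sum => a _.
  case ga : (gap_aligned i a); first exact: step_sign_scale.
  by rewrite sumr_ge0 // => s _; rewrite sqr_ge0.
rewrite expr_div_n expr1n mulrAC mul1r ler_pdivrMr ?exprn_gt0 ?mulr_gt0 //.
move=> /(le_trans count_le); rewrite !exprMn; lra.
Qed.

End DyadicScales.

Lemma near_right0_lower_bound (R : realType) (I : finType) (f : I -> R) :
  \forall r \near 0^'+, forall i, 0 < f i -> r <= f i.
Proof.
apply: filter_forall => i; have [fi0|_] := ltP 0 (f i); last by near=> r.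
by near=> r => _; near: r; apply: nbhs_right_le.
Unshelve. all: end_near. Qed.

Lemma sum_aligned_le (R : realType) n d (kappa : R) (w : 'I_n -> 'rV[R]_d)
    (pr : 'I_d -> 'I_n -> 'I_n) :
  1 <= kappa -> (forall i, involutive (pr i)) -> (0 < n)%N ->
  (\sum_i \sum_a aligned kappa i (w a - w (pr i a)))%:R <=
    (48 * kappa) ^+ 2 * n%:R * ln (n + n)%:R :> R.
Proof.
move=> kappa1 prK n0; pose gap i a := w a - w (pr i a).
pose gap_sqr (ia : 'I_d * 'I_n) := dotp (gap ia.1 ia.2) (gap ia.1 ia.2).
have [r [r_le [r0 r1]]] := filter_ex (filterI (near_right0_lower_bound gap_sqr)
  (filterI (nbhs_right_gt (0 : R)) (nbhs_right_le (ltr01 : 0 < 1 :> R)))).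
have cw i a : r^-1 *: w a - r^-1 *: w (pr i a) = r^-1 *: gap i a by rewrite scalerBr.
have c0 : r^-1 != 0 by rewrite invr_neq0 // gt_eqF.
have := @sum_aligned_ge1_le R n d kappa (fun a => r^-1 *: w a) pr prK kappa1.
under eq_bigr do under eq_bigr do rewrite cw alignedZ //.
apply=> // i a; rewrite cw alignedZ // => /andP[gap0 _].
rewrite dotpZl dotpZr mulrA -expr2 exprVn ler_pdivlMl ?exprn_gt0 // mulr1.
by apply: le_trans (r_le (i, a) gap0); rewrite expr2 ler_piMl // ltW.
Unshelve. all: end_near. Qed.

(** * Random normalisation *)

Section RandomDirection.
Variables (R : realType) (d : nat).
Implicit Types u z : 'rV[R]_d.

Lemma dotp_sign_row u xs : size xs = d ->
  dotp u (sign_row R d xs) = signed_sum [seq u 0 k | k <- enum 'I_d] xs.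
Proof. by move=> sxs; rewrite signed_sum_enum. Qed.

Lemma avg_sqr_dotp_sign_row u : avg d (fun xs => dotp u (sign_row R d xs) ^+ 2) = dotp u u.
Proof.
under eq_avg => xs sxs do rewrite dotp_sign_row //.
have := avg_sqr_signed_sum [seq u 0 k | k <- enum 'I_d].
by rewrite size_map size_enum_ord big_map big_enum sum_sqr_dotp.
Qed.

Lemma avg_exp4_dotp_sign_row_le u :
  avg d (fun xs => dotp u (sign_row R d xs) ^+ 4) <= 3 * dotp u u ^+ 2.
Proof.
under eq_avg => xs sxs do rewrite dotp_sign_row //.
have := avg_exp4_signed_sum_le [seq u 0 k | k <- enum 'I_d].
by rewrite size_map size_enum_ord big_map big_enum sum_sqr_dotp.
Qed.

Definition favours (rho z u : 'rV[R]_d) : bool := dotp u rho ^+ 2 < 4 * dotp z rho ^+ 2.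

Lemma avg_favours_ge u z : dotp u u = 1 -> dotp z z = 1 ->
  3 / 17 <= avg d (fun xs => (favours (sign_row R d xs) z u)%:R) :> R.
Proof.
move=> uu zz; pose F xs := 4 * dotp z (sign_row R d xs) ^+ 2 - dotp u (sign_row R d xs) ^+ 2.
have avgF : avg d F = 3.
  rewrite avgD avgZ avg_sqr_dotp_sign_row zz; under eq_avg do rewrite -mulN1r.
  by rewrite avgZ avg_sqr_dotp_sign_row uu; ring.
have avgF2 : avg d (fun xs => F xs ^+ 2) <= 51.
  apply: le_trans (_ : avg d (fun xs => 16 * dotp z (sign_row R d xs) ^+ 4
      + dotp u (sign_row R d xs) ^+ 4) <= _).
    apply: avg_le => xs _; rewrite /F.
    move: (dotp z _) (dotp u _) => s r.
    have : 0 <= s ^+ 2 * r ^+ 2 by rewrite mulr_ge0 ?sqr_ge0.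
    lra.
  have := avg_exp4_dotp_sign_row_le u; have := avg_exp4_dotp_sign_row_le z.
  by rewrite avgD avgZ uu zz; lra.
have favours_ge0 : 0 <= avg d (fun xs => (0 < F xs)%R%:R) :> R.
  by apply: avg_ge0 => xs; apply: ler0n.
under eq_avg do rewrite /favours -subr_gt0.
by have := avg_Paley_Zygmund (T := d) (F := F); rewrite avgF => /(_ ltac:(lra)); nra.
Qed.

End RandomDirection.

Lemma exists_nonroot (R : numDomainType) (p : {poly R}) : p != 0 -> exists x, ~~ root p x.
Proof.
move=> p0; pose rs : seq R := [seq k%:R | k <- iota 0 (size p)].
have uniq_rs : uniq rs by rewrite map_inj_uniq ?iota_uniq //; apply: (mulrIn (oner_neq0 R)).
have [/(max_poly_roots p0)/(_ uniq_rs)|/allPn[x _ px]] := boolP (all (root p) rs); last by exists x.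
by rewrite size_map size_iota ltnn.
Qed.

Lemma exists_generic_row (R : realType) d (J : finType) (v : J -> 'rV[R]_d) :
  exists eta, forall j, v j != 0 -> dotp (v j) eta != 0.
Proof.
have [|x] := @exists_nonroot R (\prod_(j | v j != 0) rVpoly (v j)).
  apply/prodf_neq0 => j; apply: contra_neq => /(congr1 (poly_rV (d := d))).
  by rewrite rVpolyK linear0.
rewrite rootE horner_prod => /prodf_neq0 nz; exists (\row_k x ^+ k) => j /nz.
rewrite (horner_coef_wide _ (size_poly _ _)); congr (_ != 0); apply: eq_bigr => k _.
by rewrite coef_rVpoly_ord mxE.
Qed.

Section Perturbation.
Variables (R : realType) (d : nat) (rho eta : 'rV[R]_d).
Implicit Types u z : 'rV[R]_d.

Let perturb u t : dotp u (rho + t *: eta) = dotp u rho + t * dotp u eta.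
Proof. by rewrite dotpDr dotpZr. Qed.

Lemma cvg_dotp_perturb u : dotp u (rho + t *: eta) @[t --> 0^'+] --> dotp u rho.
Proof.
have : dotp u rho + t * dotp u eta @[t --> 0^'+] --> dotp u rho + 0 * dotp u eta.
  apply: cvgD; first exact: cvg_cst.
  by apply: cvgM; [apply: cvg_at_right_filter; apply: cvg_id|apply: cvg_cst].
by under eq_fun do rewrite -perturb; rewrite mul0r addr0.
Qed.

Lemma near_dotp_perturb_neq0 u : dotp u eta != 0 ->
  \forall t \near 0^'+, dotp u (rho + t *: eta) != 0.
Proof.
move=> u_eta; have [u_rho0|u_rho] := eqVneq (dotp u rho) 0; last first.
  by apply: cvgr_neq0 u_rho; apply: cvg_dotp_perturb.
near=> t; have t0 : t != 0 by near: t; apply: nbhs_right_neq.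
by rewrite perturb u_rho0 add0r mulf_neq0.
Unshelve. all: end_near. Qed.

Lemma near_favours_perturb z u : favours rho z u ->
  \forall t \near 0^'+, favours (rho + t *: eta) z u.
Proof.
move=> fav; near=> t; rewrite /favours -subr_gt0; near: t.
have diff_cvg : 4 * dotp z (rho + t *: eta) ^+ 2 - dotp u (rho + t *: eta) ^+ 2
    @[t --> 0^'+] --> 4 * dotp z rho ^+ 2 - dotp u rho ^+ 2.
  apply: cvgB; last by apply: cvgM; apply: cvg_dotp_perturb.
  by apply: cvgM; [apply: cvg_cst|apply: cvgM; apply: cvg_dotp_perturb].
by apply: (cvgr_gt _ diff_cvg); rewrite subr_gt0.
Unshelve. all: end_near. Qed.

End Perturbation.

(* A sign vector realising the average may be orthogonal to some [v j]; a small generic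
   perturbation avoids this and keeps the strict inequalities. *)
Lemma exists_favouring_direction (R : realType) d (I J : finType) (P : pred I)
    (U Z : I -> 'rV[R]_d) (v : J -> 'rV[R]_d) :
  (forall i, P i -> dotp (U i) (U i) = 1 /\ dotp (Z i) (Z i) = 1) ->
  exists2 rho, forall j, v j != 0 -> dotp (v j) rho != 0 &
    3 / 17 * #|P|%:R <= \sum_(i | P i) (favours rho (Z i) (U i))%:R :> R.
Proof.
move=> UZ; have : 3 / 17 * #|P|%:R <=
    avg d (fun xs => \sum_(i | P i) (favours (sign_row R d xs) (Z i) (U i))%:R) :> R.
  rewrite avg_sum mulr_natr -sumr_const; apply: ler_sum => i /UZ[uu zz].
  exact: avg_favours_ge.
move=> /avg_exists[xs _ xsP]; set rho := sign_row R d xs in xsP.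
have [eta etaP] := exists_generic_row v.
have generic : \forall t \near 0^'+, forall j, v j != 0 -> dotp (v j) (rho + t *: eta) != 0.
  apply: filter_forall => j; have [_|/etaP v_eta] := eqVneq (v j) 0; first by near=> t.
  by near=> t => _; near: t; apply: near_dotp_perturb_neq0.
have favouring : \forall t \near 0^'+, forall i,
    favours rho (Z i) (U i) -> favours (rho + t *: eta) (Z i) (U i).
  apply: filter_forall => i; have [fav|_] := boolP (favours rho _ _); last by near=> t.
  by near=> t => _; near: t; apply: near_favours_perturb.
have [t [vt favt]] := filter_ex (filterI generic favouring).
exists (rho + t *: eta) => //; apply: le_trans xsP _; apply: ler_sum => i _.
by have := favt i; case: (favours rho _ _) => [->|_] //; rewrite ler0n.
Unshelve. all: end_near. Qed.

Lemma memv_span2 (K : fieldType) (vT : vectType K) (a b u : vT) :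
  u \in <<[:: a; b]>>%VS -> exists x y, u = x *: a + y *: b.
Proof.
rewrite span_cons span_seq1 => /memv_addP[_ /vlineP[x ->] [_ /vlineP[y ->] ->]].
by exists x, y.
Qed.

Section Planes.
Variables (R : realType) (d : nat).
Implicit Types (u v z rho y : 'rV[R]_d) (V : {vspace 'rV[R]_d}).

Lemma exists_orthonormal_frame u V : dotp u u = 1 -> u \in V -> \dim V = 2 ->
  exists z, [/\ dotp z z = 1, dotp u z = 0 & V = <<[:: u; z]>>%VS].
Proof.
move=> uu uV V2; have u0 : u != 0 := dotp_unit_neq0 uu.
have /subvPn[v vV v_u] : ~~ (V <= <[u]>)%VS.
  by apply/negP => /dimvS; rewrite V2 dim_vline u0.
have [|c c0 cc] := @exists_unit_scale R d (v - dotp v u *: u).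
  by apply: contraNneq v_u => /eqP; rewrite subr_eq0 => /eqP ->; rewrite memvZ ?memv_line.
set z := c *: _ in cc; exists z.
have uz : dotp u z = 0 by rewrite /z !dotp_lin uu (dotpC v); ring.
split=> //; apply/esym/eqP; rewrite eqEdim V2; apply/andP; split.
  apply/span_subvP => w; rewrite !inE => /orP[]/eqP-> //.
  by rewrite memvZ // memvB // memvZ.
suff : free [:: u; z] by rewrite /free => /eqP ->.
rewrite free_cons span_seq1 seq1_free (dotp_unit_neq0 cc) andbT.
apply: contra_neqN u0 => /vlineP[r uE].
by move: uz; rewrite uE dotpZl cc mulr1 => ->; rewrite scale0r.
Qed.

(* [15 / 16] is a rational lower bound for [alpha0 ^ 2], coming from [2 <= pi]. *)
Definition near_axis (i : 'I_d) u : Prop := dotp u u = 1 /\ 15 / 16 <= u 0 i ^+ 2.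

Lemma aligned_of_favours i u z rho y : near_axis i u -> dotp z z = 1 -> dotp u z = 0 ->
  favours rho z u -> y \in <<[:: u; z]>>%VS -> y != 0 -> dotp y rho = 0 -> aligned 5 i y.
Proof.
move=> [uu ui] zz uz fav /memv_span2[r [s yE]] /dotp_gt0 y0 y_rho.
have yy : dotp y y = r ^+ 2 + s ^+ 2.
  by rewrite yE !dotp_lin uu zz uz (dotpC z u) uz; ring.
have : s ^+ 2 * dotp z rho ^+ 2 = r ^+ 2 * dotp u rho ^+ 2.
  rewrite -!exprMn -sqrrN; congr (_ ^+ 2); move: y_rho; rewrite yE !dotp_lin; lra.
move: fav; rewrite /favours; set U := dotp u rho ^+ 2; set Z := dotp z rho ^+ 2 => fav sZrU.
have Z0 : 0 < Z by have := sqr_ge0 (dotp u rho); rewrite -/U; lra.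
have s_le : s ^+ 2 <= 4 * r ^+ 2.
  rewrite -(ler_pM2r Z0) sZrU; have := ler_wpM2l (sqr_ge0 r) (ltW fav); lra.
have zi : z 0 i ^+ 2 <= 1 / 16 by have := bessel2 i uu zz uz; lra.
have ru_ge : 15 / 16 * r ^+ 2 <= (r * u 0 i) ^+ 2.
  by rewrite exprMn mulrC ler_wpM2l ?sqr_ge0.
have sz_le : (s * z 0 i) ^+ 2 <= r ^+ 2 / 4.
  rewrite exprMn; apply: le_trans (_ : (4 * r ^+ 2) * (1 / 16) <= _); last by lra.
  by apply: ler_pM; rewrite ?sqr_ge0.
rewrite /aligned y0 /= yy yE !mxE.
move: (r * u 0 i) (s * z 0 i) ru_ge sz_le => a b ru_ge sz_le.
have := sqr_ge0 (a + 2 * b); lra.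
Qed.

Definition normalized_diff rho v w : 'rV[R]_d :=
  (dotp v rho)^-1 *: v - (dotp w rho)^-1 *: w.

Lemma normalized_diff_aligned i u z v w rho : near_axis i u -> dotp z z = 1 -> dotp u z = 0 ->
  <<[:: v; w]>>%VS = <<[:: u; z]>>%VS -> free [:: v; w] ->
  dotp v rho != 0 -> dotp w rho != 0 -> favours rho z u ->
  aligned 5 i (normalized_diff rho v w).
Proof.
move=> ui zz uz vw_uz vw v_rho w_rho fav.
apply: (aligned_of_favours ui zz uz fav).
- by rewrite -vw_uz memvB // memvZ // memv_span // !inE eqxx ?orbT.
- rewrite subr_eq0; apply: contraL vw => /eqP vE; rewrite free_cons negb_and negbK.
  by rewrite -[v](scalerKV v_rho) vE span_seq1 !memvZ ?memv_line.
- by rewrite /normalized_diff !dotp_lin !mulVf // subrr.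
Qed.

Definition heavy (i : 'I_d) v : bool := dotp v v < 2 * v 0 i ^+ 2.

Lemma sum_heavy_le1 v : (\sum_i heavy i v <= 1)%N.
Proof.
case: (pickP (heavy^~ v)) => [i hi|h0]; last by rewrite big1 // => i _; rewrite h0.
rewrite (bigD1 i) //= hi big1 // => j ji; apply/eqP; rewrite eqb0; apply/negP => hj.
have : v 0 i ^+ 2 + v 0 j ^+ 2 <= dotp v v.
  rewrite -sum_sqr_dotp (bigD1 i) //= (bigD1 j) //= addrA lerDl.
  by rewrite sumr_ge0 // => k _; rewrite sqr_ge0.
by move: hi hj; rewrite /heavy; lra.
Qed.

Lemma heavy_of_parallel i u v : near_axis i u -> u \in <[v]>%VS -> heavy i v.
Proof.
move=> [uu ui] /vlineP[c uE]; move: uu ui; rewrite uE !dotp_lin mxE exprMn mulrA -expr2.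
rewrite /heavy; set x := dotp v v => cx cv.
have c0 : 0 < c ^+ 2.
  rewrite lt_def sqr_ge0 andbT; apply: contra_eq_neq cx => ->.
  by rewrite mul0r eq_sym oner_eq0.
by rewrite -(ltr_pM2l c0); lra.
Qed.

Lemma free_or_heavy i u v w : near_axis i u -> u \in <<[:: v; w]>>%VS ->
  [|| free [:: v; w], heavy i v | heavy i w].
Proof.
move=> ui; rewrite free_cons seq1_free span_cons !span_seq1.
have [vw|_] /= := boolP (v \in <[w]>%VS).
  by rewrite (addv_idPr vw) => /(heavy_of_parallel ui) ->; rewrite orbT.
have [->|//] := eqVneq w 0.
have /addv_idPl -> : (<[0]> <= <[v]>)%VS by rewrite -memvE mem0v.
by move=> /(heavy_of_parallel ui) ->.
Qed.

End Planes.

Section Counting.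
Variables (R : realType) (n d : nat) (v : 'I_n -> 'rV[R]_d) (pr : 'I_d -> 'I_n -> 'I_n).
Hypothesis prK : forall i, involutive (pr i).
Hypothesis pair_spans : forall i a, pr i a != a ->
  exists2 u, near_axis i u & u \in <<[:: v a; v (pr i a)]>>%VS.

Let free_pair i a := free [:: v a; v (pr i a)].

Lemma sum_paired_le_free :
  (\sum_i \sum_a (pr i a != a) <= \sum_i \sum_a free_pair i a + 2 * n)%N.
Proof.
have heavy_le : (\sum_i \sum_a heavy i (v a) <= n)%N.
  rewrite exchange_big /= -[X in (_ <= X)%N]card_ord -sum1_card.
  by apply: leq_sum => a _; apply: sum_heavy_le1.
have heavy_pr_le : (\sum_i \sum_a heavy i (v (pr i a)) <= n)%N.
  rewrite (eq_bigr (fun i => \sum_a heavy i (v a))%N) // => i _.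
  by rewrite [RHS](reindex_inj (inv_inj (prK i))).
rewrite mul2n -addnn; apply: leq_trans (leq_add (leqnn _) (leq_add heavy_le heavy_pr_le)).
rewrite -!big_split; apply: leq_sum => i _; rewrite -!big_split; apply: leq_sum => a _ /=.
have [//|/pair_spans[u ui uV]] := eqVneq (pr i a) a.
have := free_or_heavy ui uV; rewrite -/(free_pair i a).
by case: (free_pair i a); case: (heavy i (v a)); case: (heavy i _).
Qed.

Lemma free_pair_frame i a : free_pair i a -> exists uz : 'rV[R]_d * 'rV[R]_d,
  [/\ near_axis i uz.1, dotp uz.2 uz.2 = 1, dotp uz.1 uz.2 = 0 &
      <<[:: v a; v (pr i a)]>>%VS = <<[:: uz.1; uz.2]>>%VS].
Proof.
move=> fr; have : pr i a != a.
  by apply: contraTneq fr => pra; rewrite /free_pair pra free_cons span_seq1 memv_line.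
move=> /pair_spans[u ui uV]; have V2 : \dim <<[:: v a; v (pr i a)]>> = 2 by apply/eqP.
by have [z [zz uz VE]] := exists_orthonormal_frame ui.1 uV V2; exists (u, z).
Qed.

Lemma sum_free_pair_le : (0 < n)%N ->
  (\sum_i \sum_a free_pair i a)%:R <= 17 / 3 * (240 ^+ 2 * n%:R * ln (n + n)%:R) :> R.
Proof.
move=> n0; pose P (ia : 'I_d * 'I_n) := free_pair ia.1 ia.2.
have /choice[uz uzP] : forall ia, exists uz : 'rV[R]_d * 'rV[R]_d, P ia ->
    [/\ near_axis ia.1 uz.1, dotp uz.2 uz.2 = 1, dotp uz.1 uz.2 = 0 &
      <<[:: v ia.2; v (pr ia.1 ia.2)]>>%VS = <<[:: uz.1; uz.2]>>%VS].
  move=> ia; have [/free_pair_frame[uz uzP]|_] := boolP (P ia); first by exists uz.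
  by exists (0, 0).
have [ia|rho v_rho] := @exists_favouring_direction R d _ _ P (fst \o uz) (snd \o uz) v.
  by move=> /uzP[[uu _] zz _ _].
have -> : #|P|%:R = (\sum_i \sum_a free_pair i a)%:R :> R.
  by rewrite pair_bigA /= -sum1_card big_mkcond.
set w := fun a => (dotp (v a) rho)^-1 *: v a.
have favours_le : \sum_(ia | P ia) (favours rho (uz ia).2 (uz ia).1)%:R <=
    (\sum_i \sum_a aligned 5 i (w a - w (pr i a)))%:R :> R.
  rewrite pair_bigA natr_sum big_mkcond; apply: ler_sum => -[i a] _ /=.
  case: ifP => [fr|_]; last by rewrite ler0n.
  have [ui zz uz0 VE] := uzP _ fr; have fr_neq0 := free_not0 fr.
  have va0 : v a != 0 by apply: fr_neq0; rewrite !inE eqxx.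
  have vpa0 : v (pr i a) != 0 by apply: fr_neq0; rewrite !inE eqxx orbT.
  have := normalized_diff_aligned ui zz uz0 VE fr (v_rho _ va0) (v_rho _ vpa0).
  by case: (favours _ _ _) => [->|_] //; rewrite ler0n.
have kappa1 : 1 <= 5 :> R by rewrite ler1n.
have := le_trans favours_le (sum_aligned_le w kappa1 prK n0); rewrite /=; lra.
Qed.

Lemma sum_paired_le : (0 < n)%N ->
  (\sum_i \sum_a (pr i a != a))%:R <=
    2 * n%:R + 17 / 3 * (240 ^+ 2 * n%:R * ln (n + n)%:R) :> R.
Proof.
move=> n0; apply: le_trans (_ : (\sum_i \sum_a free_pair i a + 2 * n)%:R <= _).
  by rewrite ler_nat sum_paired_le_free.
by rewrite natrD natrM addrC lerD2l sum_free_pair_le.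
Qed.

End Counting.

(** * The rate of the code *)

Section Partner.
Variables (T : finType) (P : {set {set T}}).
Hypothesis tiP : trivIset P.
Implicit Types a b : T.

Definition partner a : T := odflt a [pick b | (b != a) && ([set a; b] \in P)].

Lemma partner_edge a : partner a != a -> [set a; partner a] \in P.
Proof. by rewrite /partner; case: pickP => [b /andP[] //|_] /=; rewrite eqxx. Qed.

Lemma edge_partner a b : b != a -> [set a; b] \in P -> partner a = b.
Proof.
move=> ba abP; rewrite /partner; case: pickP => [c /andP[ca acP]|/(_ b)] /=; last by rewrite ba abP.
have abE : [set a; c] = [set a; b].
  by rewrite -(def_pblock tiP acP (set21 a c)) -(def_pblock tiP abP (set21 a b)).
have : c \in [set a; b] by rewrite -abE set22.
by rewrite !inE (negbTE ca) => /eqP.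
Qed.

Lemma partnerK : involutive partner.
Proof.
move=> a; have [pa|pa] := eqVneq (partner a) a; first by rewrite !pa.
by apply: edge_partner; rewrite 1?eq_sym // setUC partner_edge.
Qed.

Lemma card_matching_le : (forall A : {set T}, A \in P -> #|A| = 2) ->
  (#|P| <= \sum_a (partner a != a))%N.
Proof.
move=> P2; have -> : (\sum_a (partner a != a) = #|[set a | partner a != a]|)%N.
  by rewrite -sum1dep_card [RHS]big_mkcond; apply: eq_bigr => a _; case: (_ != _).
apply: leq_trans (_ : #|cover P| <= _)%N.
  by rewrite -(eqP tiP) -sum1_card; apply: leq_sum => A /P2 ->.
apply/subset_leq_card/subsetP => a /bigcupP[A AP aA]; rewrite inE.
have /cards2P[x [y [xy E]]] : #|A| == 2 by rewrite P2.
move: aA AP; rewrite E !inE => /orP[]/eqP -> xyP.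
  by rewrite (edge_partner _ xyP) // eq_sym.
by rewrite setUC in xyP; rewrite (edge_partner _ xyP).
Qed.

End Partner.

Lemma alpha0_sqr_ge (R : realType) (alpha : R) : alpha0 R < alpha -> 15 / 16 <= alpha ^+ 2.
Proof.
move=> lt_alpha; have a0 : 0 <= alpha0 R by rewrite sqrtr_ge0.
have pi2_ge : 4 <= (pi : R) ^+ 2 by have := pi_ge2 R; nra.
have inv_le : 1 / (4 * pi ^+ 2) <= 1 / 16 :> R by rewrite !div1r lef_pV2 ?posrE; lra.
have : alpha0 R ^+ 2 = 1 - 1 / (4 * pi ^+ 2) by rewrite sqr_sqrtr //; lra.
have : alpha0 R ^+ 2 <= alpha ^+ 2 by rewrite lerXn2r ?nnegrE // ltW // (le_lt_trans a0).
lra.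
Qed.

Lemma sqr_coord_ge_weight (R : realType) d (alpha : R) (u : 'rV[R]_d) i :
  0 <= alpha -> u != 0 -> alpha <= weight i u -> alpha ^+ 2 * dotp u u <= u 0 i ^+ 2.
Proof.
move=> a0 /dotp_gt0 uu; rewrite /weight dotp_delta ler_pdivlMr ?sqrtr_gt0 // => h.
rewrite -[dotp u u]sqr_sqrtr ?(ltW uu) // -exprMn -[leRHS]real_normK ?num_real //.
by rewrite lerXn2r ?nnegrE // mulr_ge0 // sqrtr_ge0.
Qed.

Lemma near_axis_of_weight (R : realType) d (alpha : R) (u : 'rV[R]_d) i :
  0 <= alpha -> 15 / 16 <= alpha ^+ 2 -> u != 0 -> alpha <= weight i u ->
  exists c, near_axis i (c *: u).
Proof.
move=> a0 a2 u0 /(sqr_coord_ge_weight a0 u0) ui.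
have [c c0 cc] := exists_unit_scale u0; exists c; split=> //.
move: cc; rewrite dotpZl dotpZr mulrA -expr2 => cc; apply: le_trans a2 _.
by rewrite mxE exprMn -[leLHS]mulr1 -cc mulrCA ler_wpM2l ?sqr_ge0.
Qed.

Lemma sub_span_edge (K : fieldType) (vT : vectType K) (T : finType) (v : T -> vT) a b :
  (<<[seq v j | j <- enum [set a; b]]>> <= <<[:: v a; v b]>>)%VS.
Proof.
apply: sub_span => _ /mapP[j + ->].
by rewrite mem_enum !inE => /orP[]/eqP->; rewrite eqxx ?orbT.
Qed.

Section Rate.
Variables (R : realType) (alpha delta : R) (n d : nat).
Variables (v : 'I_n -> 'rV[R]_d) (M : 'I_d -> {set {set 'I_n}}).
Hypothesis alpha_ge0 : 0 <= alpha.
Hypothesis alpha2_ge : 15 / 16 <= alpha ^+ 2.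
Hypothesis ldc : approx_LDC 2 alpha delta v M.

Lemma LDC_rate_le : (0 < n)%N -> delta * d%:R <= 2 + 17 / 3 * 240 ^+ 2 * ln (n + n)%:R.
Proof.
have [matching decode rate] := ldc; move=> n0; pose pr i := partner (M i).
have prK i : involutive (pr i) by apply: partnerK; case: (matching i).
have pair_spans i a : pr i a != a ->
    exists2 u, near_axis i u & u \in <<[:: v a; v (pr i a)]>>%VS.
  move=> /partner_edge/decode[u [uV u0 u_weight]].
  have [c cu] := near_axis_of_weight alpha_ge0 alpha2_ge u0 u_weight.
  by exists (c *: u) => //; rewrite memvZ // (subvP (sub_span_edge _ _ _)).
have matched_le : (\sum_i #|M i|)%:R <= (\sum_i \sum_a (pr i a != a))%:R :> R.
  by rewrite ler_nat; apply: leq_sum => i _; apply: card_matching_le; case: (matching i).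
have n0' : 0 < n%:R :> R by rewrite ltr0n.
rewrite -(ler_pM2r n0').
by have := le_trans (le_trans rate matched_le) (sum_paired_le prK pair_spans n0); lra.
Qed.

Lemma LDC_rate_le_ln : (0 < n)%N -> delta * d%:R <= (4 + 34 / 3 * 240 ^+ 2) * ln n%:R.
Proof.
move=> n0; have [n1|n1] := leqP n 1.
  have nE : n%:R = 1 :> R by apply/eqP; rewrite pnatr_eq1 eqn_leq n1.
  have [matching _] := ldc; rewrite nE ln1 mulr0 mulr1 big1 // => i _.
  apply/eqP; rewrite cards_eq0; apply/set0Pn => -[A /(proj2 (matching i)) A2].
  by have := max_card (mem A); rewrite A2 card_ord leqNgt ltnS n1.
have n_gt0 : 0 < n%:R :> R by rewrite ltr0n.
have ln2_ge : 1 / 2 <= ln 2 :> R.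
  have : ln (1 + - (1 / 2)) <= - (1 / 2) :> R by apply: le_ln1Dx; lra.
  have -> : 1 + - (1 / 2) = 2^-1 :> R by field.
  by rewrite lnV ?posrE; lra.
have ln2_le : ln 2 <= ln n%:R :> R by rewrite ler_ln ?posrE // ler_nat.
by have := LDC_rate_le n0; rewrite addnn -mul2n natrM lnM ?posrE //; lra.
Qed.

End Rate.

Theorem theorem2 (R : realType) (alpha : R)
    (halpha0 : alpha0 R < alpha) (halpha1 : alpha <= 1) :
  exists c : R, 0 < c /\
    forall (d n : nat) (delta : R) (v : 'I_n -> 'rV[R]_d)
      (M : 'I_d -> {set {set 'I_n}}),
      (0 < d)%N -> (0 < n)%N -> 0 <= delta -> delta <= 1 ->
      approx_LDC 2 alpha delta v M ->
      2 `^ (c * delta * d%:R) <= n%:R.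
Proof.
have alpha_ge0 : 0 <= alpha by apply: le_trans (ltW halpha0); rewrite sqrtr_ge0.
have alpha2_ge := alpha0_sqr_ge halpha0.
pose C : R := 4 + 34 / 3 * 240 ^+ 2; have C0 : 0 < C by rewrite /C; lra.
exists C^-1; split; first by rewrite invr_gt0.
move=> d n delta v M _ n0 delta0 _ ldc.
have rate := LDC_rate_le_ln alpha_ge0 alpha2_ge ldc n0.
have ln2_le1 : ln 2 <= 1 :> R by rewrite -[2]/(1 + 1) le_ln1Dx //; lra.
rewrite -ler_ln ?posrE ?powR_gt0 ?ltr0n // ln_powR -(mulrA _ delta).
apply: le_trans (_ : C^-1 * (delta * d%:R) <= _); last by rewrite ler_pdivrMl.
by rewrite ler_piMr // mulr_ge0 ?invr_ge0 ?mulr_ge0 ?(ltW C0) ?ler0n.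
Qed.
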